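(* Let $\mathcal{P}$ be a simple (weakly connected) collection of cells with connected components $\mathcal{P}_1,\dots,\mathcal{P}_n$, and $K$ a field. If $h_{K[\mathcal{P}_i]}(t)$ denotes the $h$-polynomial of $K[\mathcal{P}_i]$, then $\prod_{i=1}^n h_{K[\mathcal{P}_i]}(t)$ is the $h$-polynomial of $K[\mathcal{P}]$.
   Context: Intervals: for $a\le b$ in $\mathbb{Z}^2$ (componentwise) $[a,b]$ is the set of lattice points between them, proper if both coordinates are strictly smaller; diagonal corners $a,b$, anti-diagonal corners $(a_1,b_2),(b_1,a_2)$. A cell is $[a,a+(1,1)]$. A collection of cells is a finite non-empty set of cells which is weakly connected (any two cells joined by a sequence of its cells with consecutive ones sharing a vertex). A polyomino is a collection in which any two cells are joined by a sequence of cells of it, consecutive ones sharing an edge; a connected component is a maximal sub-polyomino. $\mathcal{P}$ is simple if any two cells of $\mathbb{Z}^2$ not in $\mathcal{P}$ are joined by such an edge-sharing sequence of cells not in $\mathcal{P}$. An inner interval of $\mathcal{P}$ is a proper interval all of whose cells lie in $\mathcal{P}$; its inner 2-minor is $x_ax_b-x_cx_d$. $K[\mathcal{P}]=S_{\mathcal{P}}/I_{\mathcal{P}}$ where $S_{\mathcal{P}}=K[x_v:v\in V(\mathcal{P})]$ (standard grading) and $I_{\mathcal{P}}$ is generated by the inner 2-minors. The $h$-polynomial of a standard graded algebra $R$ of Krull dimension $d$ is the polynomial $h(t)$ with $h(1)\ne 0$ such that the Hilbert–Poincaré series is $h(t)/(1-t)^d$. *)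

(* Defs.v *)
From HB Require Import structures.
From mathcomp Require Import all_boot all_order all_algebra.
From mathcomp Require Import finmap.
From mathcomp Require Import mpoly.

Set Implicit Arguments.
Unset Strict Implicit.
Unset Printing Implicit Defensive.

Import Order.TTheory GRing.Theory Num.Theory.
Local Open Scope ring_scope.

Definition pt2 := (int * int)%type.

(* A cell [a, a+(1,1)] is represented by its lower-left corner a.
   Its vertices (the lattice points of the interval): *)
Definition cverts (c : pt2) : seq pt2 :=
  [:: c; ((fst c) + 1, (snd c)); ((fst c), (snd c) + 1); ((fst c) + 1, (snd c) + 1)].

Definition share_vertex (c d : pt2) : bool :=
  has (fun v => v \in cverts d) (cverts c).

Definition share_edge (c d : pt2) : bool :=
  (c != d) && (1 < count (fun v => v \in cverts d) (cverts c))%N.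

Definition joined (r : rel pt2) (A : pred pt2) (c d : pt2) : Prop :=
  exists s : seq pt2, all A s /\ path r c s /\ last c s = d.

Definition is_collection (P : {fset pt2}) : Prop :=
  P != fset0 /\
  forall c d, c \in P -> d \in P -> joined share_vertex (fun x => x \in P) c d.

Definition is_polyomino (P : {fset pt2}) : Prop :=
  P != fset0 /\
  forall c d, c \in P -> d \in P -> joined share_edge (fun x => x \in P) c d.

Definition is_component (P Q : {fset pt2}) : Prop :=
  (Q `<=` P)%fset /\ is_polyomino Q /\
  forall Q' : {fset pt2}, (Q `<=` Q')%fset -> (Q' `<=` P)%fset -> is_polyomino Q' -> Q' = Q.

Definition is_simple (P : {fset pt2}) : Prop :=
  forall c d, c \notin P -> d \notin P -> joined share_edge (fun x => x \notin P) c d.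

(* V(P), enumerated without repetition; the variables of S_P are indexed
   by positions in this list. *)
Definition VS (P : {fset pt2}) : seq pt2 :=
  undup (flatten [seq cverts c | c <- P]).
Definition nV (P : {fset pt2}) : nat := size (VS P).

Definition SP (K : fieldType) (P : {fset pt2}) := {mpoly K[nV P]}.

Definition xv (K : fieldType) (P : {fset pt2}) (v : pt2) : SP K P :=
  oapp (fun i : 'I_(nV P) => 'X_i) 0 (insub (index v (VS P))).

Definition inner_interval (P : {fset pt2}) (a b : pt2) : Prop :=
  ((fst a) < (fst b)) /\ ((snd a) < (snd b)) /\
  forall c : pt2, (fst a) <= (fst c) -> (fst c) < (fst b) -> (snd a) <= (snd c) -> (snd c) < (snd b) -> c \in P.

Definition minor2 (K : fieldType) (P : {fset pt2}) (a b : pt2) : SP K P :=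
  xv K P a * xv K P b - xv K P ((fst a), (snd b)) * xv K P ((fst b), (snd a)).

Definition in_IP (K : fieldType) (P : {fset pt2}) (p : SP K P) : Prop :=
  exists s : seq (SP K P * (pt2 * pt2)),
    (forall x, x \in s -> inner_interval P (fst (snd x)) (snd (snd x))) /\
    p = \sum_(x <- s) (fst x) * minor2 K P (fst (snd x)) (snd (snd x)).

(* f is a family of m homogeneous elements of degree k of S_P whose
   classes in K[P] = S_P/I_P are K-linearly independent *)
Definition indep_mod (K : fieldType) (P : {fset pt2}) (k m : nat)
  (f : 'I_m -> SP K P) : Prop :=
  (forall i, f i \is k.-homog) /\
  forall c : 'I_m -> K, in_IP (\sum_(i < m) c i *: f i) -> forall i, c i = 0.

Definition hilb_dim (K : fieldType) (P : {fset pt2}) (k m : nat) : Prop :=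
  (exists f : 'I_m -> SP K P, indep_mod k f) /\
  (forall f : 'I_m.+1 -> SP K P, ~ indep_mod k f).

(* h is the h-polynomial of K[P]: h(1) <> 0 and for some d the
   Hilbert-Poincare series sum_k H(k) t^k equals h(t)/(1-t)^d, i.e.
   (1-t)^d * sum_k H(k) t^k = h(t) as formal power series over Z. *)
Definition is_hpoly (K : fieldType) (P : {fset pt2}) (h : {poly int}) : Prop :=
  h.[1] != 0 /\
  exists (d : nat) (H : nat -> nat),
    (forall k, hilb_dim K P k (H k)) /\
    forall k : nat,
      h`_k = \sum_(j < d.+1 | (j <= k)%N)
               ((-1) ^+ j * ('C(d, j))%:Z * (H (k - j)%N)%:Z).

(* Main.v *)
(** The ideal is generated by differences of monomials, so K[P] has as a basis
    the classes of monomials modulo the switches x_a x_b <-> x_c x_d along inner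
    intervals, and its Hilbert function counts these classes.

    If P is simple, two monomials are in the same class as soon as they have the
    same degree on every maximal horizontal or vertical edge interval. Indeed
    their difference decomposes into closed rectilinear walks along edges of P,
    whose winding number vanishes at the cells outside P. A walk with a chord
    splits into two shorter ones; without chord, the strip below its topmost side,
    down to the end of one of the adjacent vertical sides, has nonzero winding
    number and thus lies in P, so that a switch removes a corner of the walk. In
    particular every variable is cancellable.

    A vertex v shared by two components is a cut point of P, because a path of
    cells outside P between the two missing cells at v closes up to a loop
    through v. If v cuts P into A and B, cancellability of x_v shows that each
    class of P is uniquely a class of A times a class of B not divisible by x_v.
    Hence HS(P) = HS(A) HS(B) (1 - t), and one concludes by induction on the
    number of components. *)

Require Import Defs.
From HB Require Import structures.
From mathcomp Require Import all_boot all_order all_algebra.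
From mathcomp Require Import finmap.
From mathcomp Require Import mpoly.
From mathcomp Require Import zify.
From Stdlib Require Import ClassicalEpsilon.
Set Implicit Arguments.
Unset Strict Implicit.
Unset Printing Implicit Defensive.
Import Order.TTheory GRing.Theory Num.Theory.
Local Open Scope ring_scope.

(** * Cells and switching moves *)

(* Projections occurring in membership statements are typed through the eqType
   structure of int; lia would treat them as atoms distinct from the others. *)
Ltac plia_fold T :=
  first [ unify (Equality.sort T) int;
          progress change (Equality.sort T) with int in *
        | unify (Equality.sort T) (int * int)%type;
          progress change (Equality.sort T) with (int * int)%type in * ].
Ltac plia := unfold pt2 in *; repeat
  match goal with
  | |- context [Equality.sort ?T] => plia_fold T
  | _ : context [Equality.sort ?T] |- _ => plia_fold T
  end; lia.

Lemma share_vertexP (c d : pt2) :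
  reflect (exists2 w, w \in cverts c & w \in cverts d) (share_vertex c d).
Proof. exact: hasP. Qed.

(** Excludes the contradictory truth values that remain when the coordinate equalities in
    [share_edgeE] are split by cases. *)
Lemma trichotomy1 (a b : int) :
  [&& ~~ ((a == b) && (b + 1 == a)), ~~ ((a == b) && (a + 1 == b))
    & ~~ ((b + 1 == a) && (a + 1 == b))].
Proof. lia. Qed.

Lemma share_edgeE (c d : pt2) :
  share_edge c d =
    (c.1 == d.1) && ((d.2 + 1 == c.2) || (c.2 + 1 == d.2))
 || (c.2 == d.2) && ((d.1 + 1 == c.1) || (c.1 + 1 == d.1)).
Proof.
case: c d => [a b] [a' b'].
rewrite /share_edge /cverts /= !inE !xpair_eqE /= !(inj_eq (addIr 1)).
rewrite [a == a' + 1]eq_sym [b == b' + 1]eq_sym.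
move: (trichotomy1 a a') (trichotomy1 b b').
by do 6?case: (_ == _).
Qed.

Lemma mem_cverts (v c : pt2) :
  (v \in cverts c) =
  ((v.1 == c.1) || (v.1 == c.1 + 1)) && ((v.2 == c.2) || (v.2 == c.2 + 1)).
Proof.
case: c v => [a b] [x y]; rewrite /cverts !inE !xpair_eqE /=.
by do 4?case: (_ == _).
Qed.

(** Classical truth values let the edge-interval relations serve as a [rel] in [path] and [cycle]
    and as a predicate in [count]. *)
Definition asb (Q : Prop) : bool :=
  if excluded_middle_informative Q then true else false.

Lemma asbP (Q : Prop) : reflect Q (asb Q).
Proof. by rewrite /asb; case: excluded_middle_informative => h; constructor. Qed.

Lemma joined_const (T : Type) (r : rel pt2) (A : pred pt2) (g : pt2 -> T) c d :
  (forall x y, A x -> A y -> r x y -> g x = g y) ->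
  A c -> joined r A c d -> g c = g d.
Proof.
move=> hg Ac [s [As [ps <-]]]; elim: s c Ac As ps => //= x s IH c Ac /andP[Ax As].
by case/andP=> rcx ps; rewrite (hg c x) // IH.
Qed.

(* A word stands for the monomial that is the product of the variables at its
   letters; eqv P is equality of monomials in K[P]. *)
Inductive eqv (P : {fset pt2}) : seq pt2 -> seq pt2 -> Prop :=
| eqv_perm u w : perm_eq u w -> eqv P u w
| eqv_move a b u : inner_interval P a b ->
    eqv P [:: a, b & u] [:: (a.1, b.2), (b.1, a.2) & u]
| eqv_sym u w : eqv P u w -> eqv P w u
| eqv_trans w u t : eqv P u w -> eqv P w t -> eqv P u t.

Lemma eqv_refl P u : eqv P u u.
Proof. exact: eqv_perm. Qed.

Lemma eqv_cons P x u w : eqv P u w -> eqv P (x :: u) (x :: w).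
Proof.
elim=> {u w} [u w h|a b u h|u w _ h|w u t _ h1 _ h2].
- by apply: eqv_perm; rewrite perm_cons.
- apply: (eqv_trans (w := [:: a, b, x & u])).
    by apply: eqv_perm; apply/permP => f /=; plia.
  apply: (eqv_trans (eqv_move (x :: u) h)).
  by apply: eqv_perm; apply/permP => f /=; plia.
- exact: eqv_sym.
- exact: eqv_trans h1 h2.
Qed.

Lemma eqv_cat P u1 w1 u2 w2 :
  eqv P u1 w1 -> eqv P u2 w2 -> eqv P (u1 ++ u2) (w1 ++ w2).
Proof.
have catl u u' w : eqv P u u' -> eqv P (w ++ u) (w ++ u').
  by move=> h; elim: w => //= x w IH; apply: eqv_cons.
move=> h1 h2; apply: (eqv_trans (catl _ _ _ h2)).
apply: (eqv_trans (w := w2 ++ u1)); first by apply: eqv_perm; rewrite perm_catC.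
apply: (eqv_trans (catl _ _ _ h1)); by apply: eqv_perm; rewrite perm_catC.
Qed.

Lemma eqv_size P u w : eqv P u w -> size u = size w.
Proof. by elim=> // {u w} [u w /perm_size|w u t _ -> _ ->]. Qed.

(* Whether the edge from (x, y) to (x + 1, y), resp. to (x, y + 1), lies on a
   cell of P. *)
Definition hedge (P : {fset pt2}) (x y : int) : bool :=
  ((x, y) \in P) || ((x, y - 1) \in P).

Definition vedge (P : {fset pt2}) (x y : int) : bool :=
  ((x, y) \in P) || ((x - 1, y) \in P).

(* p and q lie on a common maximal horizontal, resp. vertical, edge interval. *)
Definition hrow (P : {fset pt2}) (p q : pt2) : Prop :=
  p.2 = q.2 /\
  forall x : int, (p.1 <= x < q.1) || (q.1 <= x < p.1) -> hedge P x p.2.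

Definition vcol (P : {fset pt2}) (p q : pt2) : Prop :=
  p.1 = q.1 /\
  forall y : int, (p.2 <= y < q.2) || (q.2 <= y < p.2) -> vedge P p.1 y.

Lemma hrow_refl P p : hrow P p p.
Proof. by split=> // x; plia. Qed.

Lemma hrow_sym P p q : hrow P p q -> hrow P q p.
Proof. by move=> [h1 h2]; split=> // x hx; rewrite -h1; apply: h2; plia. Qed.

Lemma hrow_trans P q p r : hrow P p q -> hrow P q r -> hrow P p r.
Proof.
move=> [h1 h2] [h3 h4]; split=> [|x hx]; first by rewrite h1.
case: (boolP ((p.1 <= x < q.1) || (q.1 <= x < p.1))) => [/h2 //|h].
by rewrite h1; apply: h4; plia.
Qed.

Lemma vcol_refl P p : vcol P p p.
Proof. by split=> // x; plia. Qed.

Lemma vcol_sym P p q : vcol P p q -> vcol P q p.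
Proof. by move=> [h1 h2]; split=> // x hx; rewrite -h1; apply: h2; plia. Qed.

Lemma vcol_trans P q p r : vcol P p q -> vcol P q r -> vcol P p r.
Proof.
move=> [h1 h2] [h3 h4]; split=> [|x hx]; first by rewrite h1.
case: (boolP ((p.2 <= x < q.2) || (q.2 <= x < p.2))) => [/h2 //|h].
by rewrite h1; apply: h4; plia.
Qed.

(** * The switching classes of a simple collection *)

Definition link (P : {fset pt2}) : rel (pt2 * pt2) :=
  fun q q' => asb (vcol P q.2 q'.1).

(* The pairs are the horizontal sides of a closed rectilinear walk along edges
   of P; its vertical sides join the end of a pair to the start of the next. *)
Definition closed_walk (P : {fset pt2}) (s : seq (pt2 * pt2)) : Prop :=
  (forall q, q \in s -> hrow P q.1 q.2) /\ cycle (link P) s.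

(** The end of each side and the start of the next have the same [phi], so the two sums differ by a
    cyclic shift of the summands. *)
Lemma cycle_sum P (phi : pt2 -> int) s :
  (forall p q, vcol P p q -> phi p = phi q) -> cycle (link P) s ->
  \sum_(q <- s) phi q.1 = \sum_(q <- s) phi q.2.
Proof.
move=> hphi; case: s => [|q0 s] /=; first by rewrite !big_nil.
have aux q t r : path (link P) q (rcons t r) ->
    \sum_(x <- q :: t) phi x.2 = \sum_(x <- t) phi x.1 + phi r.1.
  elim: t q => [|x t IH] q /= /andP[/asbP hq ht].
    by rewrite big_nil add0r big_cons big_nil addr0 (hphi _ _ hq).
  by rewrite big_cons (IH _ ht) big_cons (hphi _ _ hq) addrA.
by move=> /aux ->; rewrite big_cons addrC.
Qed.

Definition leb (p c : pt2) : int := (((p.1 <= c.1) && (p.2 <= c.2)) : nat)%:Z.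

(** Signed number of crossings of the walk with the ray going down from the centre of [c]: a side
    counts when it passes below that centre. *)
Definition winding (s : seq (pt2 * pt2)) (c : pt2) : int :=
  \sum_(q <- s) (leb q.1 c - leb q.2 c).

Lemma lower_bound (l : seq pt2) : exists m : int, forall p, p \in l -> m < p.1.
Proof.
elim: l => [|p l [m hm]]; first by exists 0.
exists (if m <= p.1 - 1 then m else p.1 - 1) => q.
rewrite inE => /predU1P[->|/hm]; case: ifP; plia.
Qed.

Lemma winding_hstep P s (x y : int) : closed_walk P s ->
  (x, y) \notin P -> (x + 1, y) \notin P -> winding s (x + 1, y) = winding s (x, y).
Proof.
move=> [hrow hcyc] h1 h2; apply/eqP; rewrite -subr_eq0 -sumrB.
(* [phi] is the indicator of p.1 = x + 1 and p.2 <= y. Along a column it changes only across the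
   edge common to the two cells, which is not an edge of [P]. *)
pose phi (p : pt2) : int := leb p (x + 1, y) - leb p (x, y).
rewrite (eq_bigr (fun q => phi q.1 - phi q.2)); last by move=> q _; rewrite /phi; plia.
rewrite sumrB (cycle_sum (P := P) (phi := phi)) ?subrr // => p q [e hpq].
rewrite /phi /leb /= -e.
case: (p.1 =P x + 1) => [ep|]; last by plia.
have: ~~ ((p.2 <= y < q.2) || (q.2 <= y < p.2)).
  apply/negP => /hpq; rewrite /vedge ep addrK.
  by rewrite (negPf h1) (negPf h2).
plia.
Qed.

Lemma winding_vstep P s (x y : int) : closed_walk P s ->
  (x, y) \notin P -> (x, y + 1) \notin P -> winding s (x, y + 1) = winding s (x, y).
Proof.
move=> [hrow _] h1 h2; apply: eq_big_seq => q /hrow [e hq].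
rewrite /leb /= -e; case: (q.1.2 =P y + 1) => [eq|]; last by plia.
have: ~~ ((q.1.1 <= x < q.2.1) || (q.2.1 <= x < q.1.1)).
  apply/negP => /hq; rewrite /hedge eq addrK.
  by rewrite (negPf h1) (negPf h2).
plia.
Qed.

(* The winding number only changes across edges of P, so by simplicity it is
   the same at all cells outside P, including those far away. *)
Lemma winding_outside P s c : is_simple P -> closed_walk P s -> c \notin P ->
  winding s c = 0.
Proof.
move=> simP ws cP.
(* The cell (m, 0) is to the left of [P] and of the whole walk, so it has winding number 0. *)
have [m hm] := lower_bound (P ++ map fst s ++ map snd s).
have mP : (m, 0) \notin P.
  by apply/negP=> h; have:= hm (m, 0); rewrite mem_cat h => /(_ isT); rewrite ltxx.
rewrite -(joined_const (g := winding s) _ mP (simP _ _ mP cP)).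
  apply: big1_seq => q /andP[_ qs].
  have h1: m < q.1.1 by apply: hm; rewrite !mem_cat (map_f fst qs) orbT.
  have h2: m < q.2.1 by apply: hm; rewrite !mem_cat (map_f snd qs) !orbT.
  by rewrite /leb /=; plia.
move=> [x y] [x' y'] h1 h2; rewrite share_edgeE /=.
case/orP=> /andP[/eqP e] /orP[] /eqP e'; move: h1 h2; rewrite -e' ?e => h1 h2.
- exact: winding_vstep ws h2 h1.
- by rewrite (winding_vstep ws h1 h2).
- exact: winding_hstep ws h2 h1.
- by rewrite (winding_hstep ws h1 h2).
Qed.

Lemma path_link_head P q q' s : q.2 = q'.2 -> path (link P) q s = path (link P) q' s.
Proof. by case: s => //= x s e; rewrite /link e. Qed.

Lemma closed_walk_catC P s1 s2 : closed_walk P (s1 ++ s2) -> closed_walk P (s2 ++ s1).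
Proof.
move=> [h1 h2]; split; last by rewrite -rot_size_cat rot_cycle.
by move=> q; rewrite mem_cat orbC -mem_cat; apply: h1.
Qed.

(* A point z on the line of a horizontal side and on that of a vertical side
   not adjacent to it cuts the walk into two shorter ones. *)
Lemma chord_walks P q0 q1 s3 q s4 z :
  closed_walk P [:: q0, q1 & s3 ++ q :: s4] -> hrow P q.1 z -> vcol P q0.2 z ->
  closed_walk P ((z, q.2) :: rcons s4 q0) /\ closed_walk P [:: (q.1, z), q1 & s3].
Proof.
move=> [hr /=]; rewrite rcons_cat cat_path /= => /and3P[/asbP h01 h1 /andP[/asbP hl h4]] rz cz.
split; split.
- move=> x; rewrite inE mem_rcons inE => /or3P[/eqP -> | /eqP -> | xs].
  + apply: hrow_trans (hrow_sym rz) _; apply: hr.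
    by rewrite !inE mem_cat inE eqxx !orbT.
  + by apply: hr; rewrite inE eqxx.
  + by apply: hr; rewrite !inE mem_cat inE xs !orbT.
- rewrite /= rcons_path (@path_link_head P _ q) // h4 last_rcons.
  by apply/asbP.
- move=> x; rewrite !inE => /or3P[/eqP -> | /eqP -> | xs] //.
  + by apply: hr; rewrite !inE eqxx orbT.
  + by apply: hr; rewrite !inE mem_cat xs !orbT.
- rewrite /= rcons_path h1; apply/and3P; split=> //; apply/asbP => //=.
  exact: vcol_trans (vcol_sym cz) h01.
Qed.

Definition between (a b x : int) : bool := (a <= x < b) || (b <= x < a).

(* Otherwise the topmost such cell outside P would be separated from the
   outside of the walk by its top side only, and have winding number +-1. *)
Lemma strip_cells P q0 q1 s2 : is_simple P -> closed_walk P [:: q0, q1 & s2] ->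
  (forall q, q \in q1 :: s2 -> q.1.2 <= q0.1.2) ->
  (forall q z, q \in s2 -> hrow P q.1 z -> vcol P q0.2 z -> False) ->
  forall x y : int, between q0.1.1 q0.2.1 x -> q1.1.2 <= y -> y < q0.1.2 -> (x, y) \in P.
Proof.
move=> simP ws top nochord x y hx hy1 hy2.
have [n hn] : exists n : nat, q0.1.2 <= y + n%:Z.
  by exists `|q0.1.2 - y|%N; plia.
elim: n x y hx hy1 hy2 hn => [|n IH] x y hx hy1 hy2 hn; first by plia.
have [hr hc] := ws.
have [e0 r0] := hr _ (mem_head _ _).
have r1 : hrow P q1.1 q1.2 by apply: hr; rewrite !inE eqxx orbT.
have [e01 c01] : vcol P q0.2 q1.1 by move: hc => /= /andP[/asbP].
apply/negPn/negP => xyP; have w0 := winding_outside simP ws xyP.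
pose phi (p : pt2) : int := ((p.1 <= x)%R : nat)%:Z.
have := cycle_sum (P := P) (phi := phi) _ hc.
move=> /(_ (fun p q h => ltac:(by rewrite /phi (proj1 h)))) sum0.
(* [T q] is the signed crossing of [q] with the upward ray: [sum0] says that the full vertical line
   is crossed 0 times, [w0] that the downward ray is. *)
pose T q := phi q.1 - phi q.2 - (leb q.1 (x, y) - leb q.2 (x, y)).
have : \sum_(q <- [:: q0, q1 & s2]) T q = 0.
  by rewrite !sumrB sum0 subrr -sumrB -/(winding _ _) w0 subr0.
rewrite !big_cons big1_seq.
  move: hx; rewrite /T /phi /leb /between /= -e0 -(proj1 r1); plia.
move=> q /andP[_ qs].
have [eq rq] : hrow P q.1 q.2 by apply: hr; rewrite !inE qs !orbT.
have qtop : q.1.2 <= q0.1.2 by apply: top; rewrite inE qs orbT.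
(* A side of [s2] above (x, y) could be prolonged, along cells in [P] by induction, to the vertical
   side below [q0.2]: a chord. *)
case: (boolP ((y < q.1.2) && between q.1.1 q.2.1 x)) => [/andP[hq1 hq2]|]; last first.
  by rewrite /T /phi /leb /between /= -eq; plia.
case: (nochord q (q0.2.1, q.1.2) qs); split=> //=.
  move=> x' hx'; case: (boolP (between q.1.1 q.2.1 x')) => [/rq //|nx'].
  have hx'0 : between q0.1.1 q0.2.1 x'.
    by move: hx hq2 nx' hx'; rewrite /between; plia.
  case: (q.1.2 =P q0.1.2) => [->|nq]; first exact: r0.
  by rewrite /hedge IH //; plia.
by move=> y' hy'; apply: c01; plia.
Qed.

(** The rectangle between [q0] and the height of [q1] has diagonal corners [q0.1], [q1.1] and
    [q0.2], [z]. It consists of cells of [P], so one switch exchanges the two pairs, and [q0] is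
    absorbed into a side starting at [z]. *)
Lemma drop_corner P q0 q1 s2 : closed_walk P [:: q0, q1 & s2] ->
  q1.1.2 <= q0.1.2 ->
  (forall x y : int, between q0.1.1 q0.2.1 x -> q1.1.2 <= y -> y < q0.1.2 -> (x, y) \in P) ->
  exists z, closed_walk P ((z, q1.2) :: s2) /\
    forall u, eqv P [:: q0.1, q1.1 & u] [:: q0.2, z & u].
Proof.
move=> [hr hc] le10 strip.
have [e0 r0] := hr _ (mem_head _ _).
have r1 : hrow P q1.1 q1.2 by apply: hr; rewrite !inE eqxx orbT.
move: hc => /= /andP[/asbP c01]; rewrite rcons_path => /andP[hp /asbP hl].
have [e01 _] := c01.
have [z ez] : exists z : pt2, z = (q0.1.1, q1.1.2) by eexists.
exists z.
have rz : hrow P z q1.1.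
  rewrite ez; split=> // x hx; have hb : between q0.1.1 q0.2.1 x.
    by move: hx; rewrite -e01 /between /=; plia.
  rewrite /=; case: (q1.1.2 =P q0.1.2) => [->|nq]; first exact: r0.
  by rewrite /hedge strip //; plia.
have cz : vcol P q0.1 z.
  rewrite ez; split=> // y /= hy; rewrite /vedge.
  move: (ltgtP q0.1.1 q0.2.1) => [h|h|h].
  - by rewrite strip // /between; plia.
  - by rewrite (strip (q0.1.1 - 1)) ?orbT // /between; plia.
  - by rewrite h; apply: (proj2 c01); plia.
split.
  split.
    move=> q; rewrite inE => /predU1P[->|qs]; first exact: hrow_trans rz r1.
    by apply: hr; rewrite !inE qs !orbT.
  rewrite /= rcons_path (@path_link_head P _ q1) // hp; apply/asbP.
  apply: vcol_trans cz; suff -> : (last (z, q1.2) s2).2 = (last q1 s2).2 by [].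
  by case: (s2).
move=> u; move: e0 e01 le10 strip; rewrite ez /between.
case: (q0) (q1) => [[x0 y0] [xf yf]] [[x1 y1] [x2 y2]] /= <- <- le10 strip.
have [->|n1] := eqVneq y1 y0.
  by apply: eqv_perm; apply/permP => f /=; plia.
have lt10 : y1 < y0 by plia.
move: (ltgtP x0 xf) => [h|h|->].
- apply: eqv_sym; apply: (eqv_trans (w := [:: (x0, y1), (xf, y0) & u])).
    by apply: eqv_perm; apply/permP => f /=; plia.
  apply: (eqv_move (a := (x0, y1)) (b := (xf, y0))).
  do 2?split=> //; move=> [x y] /= *; apply: strip; plia.
- apply: (eqv_trans (w := [:: (xf, y1), (x0, y0) & u])).
    by apply: eqv_perm; apply/permP => f /=; plia.
  apply: (eqv_move (a := (xf, y1)) (b := (x0, y0))).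
  do 2?split=> //; move=> [x y] /= *; apply: strip; plia.
- by apply: eqv_perm.
Qed.

Lemma top_first (s : seq (pt2 * pt2)) : s != [::] ->
  exists s1 q s2, s = s1 ++ q :: s2 /\ forall q', q' \in s -> q'.1.2 <= q.1.2.
Proof.
elim: s => // q s IH _; case: s IH => [_|q' s /(_ isT) [s1 [q1 [s2 [e h]]]]].
  by exists [::], q, [::]; split=> // q'; rewrite inE => /eqP ->.
case: (lerP q.1.2 q1.1.2) => hq.
  exists (q :: s1), q1, s2; rewrite e; split=> // x; rewrite inE => /predU1P[-> //|].
  by rewrite -e; apply: h.
exists [::], q, (q' :: s); split=> // x; rewrite inE => /predU1P[-> //|/h]; plia.
Qed.

Lemma closed_walk_eqv P s : is_simple P -> closed_walk P s ->
  eqv P (map fst s) (map snd s).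
Proof.
move=> simP; have [n] := ubnP (size s); elim: n s => // n IH s sz ws.
have [->|/top_first [s1 [q0 [t [es top]]]]] := eqVneq s [::]; first exact: eqv_refl.
suff h : eqv P (map fst (q0 :: t ++ s1)) (map snd (q0 :: t ++ s1)).
  have sw (f : pt2 * pt2 -> pt2) :
      perm_eq (map f (s1 ++ q0 :: t)) (map f (q0 :: t ++ s1)).
    by rewrite -cat_cons perm_map // perm_catC.
  rewrite es; apply: (eqv_trans (eqv_perm P (sw fst))).
  by apply: (eqv_trans h); apply: eqv_sym; apply: eqv_perm; apply: sw.
have {}ws : closed_walk P (q0 :: t ++ s1).
  by rewrite -cat_cons; apply: closed_walk_catC; rewrite -es.
have {top} : forall q, q \in t ++ s1 -> q.1.2 <= q0.1.2.
  move=> q qs; apply: top; move: qs.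
  by rewrite es !mem_cat inE => /orP[] ->; rewrite ?orbT.
have : (size (t ++ s1) < n)%N.
  by move: sz; rewrite es !size_cat /=; lia.
case: (t ++ s1) ws => {t s1 es s sz} [|q1 s2] ws sz top.
  case: ws => hr /= /andP[/asbP [ex _] _]; have [ey _] := hr _ (mem_head _ _).
  by rewrite (_ : q0.1 = q0.2); [apply: eqv_refl | move: ex ey; case: (q0) => [[? ?] [? ?]] /= -> ->].
(* Arguing by contradiction makes the absence of chords available, since a chord proves the goal by
   induction. *)
apply: NNPP => nE.
have nochord q z : q \in s2 -> hrow P q.1 z -> vcol P q0.2 z -> False.
  move=> /splitPr qs rz cz; case: qs ws sz nE => s3 s4 ws sz nE; apply: nE.
  have [w1 w2] := chord_walks ws rz cz.
  have := IH _ _ w1; have := IH _ _ w2.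
  rewrite /= size_rcons; move: sz; rewrite /= size_cat /= => sz.
  move=> /(_ ltac:(lia)) h2 /(_ ltac:(lia)) h1.
  (* The second walk produces the letter [z] that the first one consumes, so no cancellation is
     required. *)
  apply: (eqv_trans (w := map fst (rcons s4 q0) ++ [:: q.1, q1.1 & map fst s3])).
    apply: eqv_perm; apply/permP => f.
    rewrite /= map_cat !count_cat /= map_rcons -cats1 count_cat /=; plia.
  apply: (eqv_trans (eqv_cat (eqv_refl _ _) h2)).
  apply: (eqv_trans (w := (z :: map fst (rcons s4 q0)) ++ (q1.2 :: map snd s3))).
    by apply: eqv_perm; apply/permP => f; rewrite /= !count_cat /=; plia.
  apply: (eqv_trans (eqv_cat h1 (eqv_refl _ _))).
  apply: eqv_perm; apply/permP => f.
  rewrite /= map_cat !count_cat /= map_rcons -cats1 count_cat /=; plia.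
apply: nE.
have strip := strip_cells simP ws top nochord.
have [z [wz hz]] := drop_corner ws (top _ (mem_head _ _)) strip.
apply: (eqv_trans (hz _)); apply: eqv_cons.
by apply: (IH _ _ wz); move: sz.
Qed.

(** * Counts on maximal edge intervals as a complete invariant *)

Definition hcount P (p : pt2) (u : seq pt2) : nat := count (fun q => asb (hrow P p q)) u.
Definition vcount P (p : pt2) (u : seq pt2) : nat := count (fun q => asb (vcol P p q)) u.

Lemma hrow_asb P p e f : hrow P e f -> asb (hrow P p e) = asb (hrow P p f).
Proof.
move=> h; apply/asbP/asbP => h'; apply: hrow_trans h' _ => //; exact: hrow_sym.
Qed.

Lemma vcol_asb P p e f : vcol P e f -> asb (vcol P p e) = asb (vcol P p f).
Proof.
move=> h; apply/asbP/asbP => h'; apply: vcol_trans h' _ => //; exact: vcol_sym.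
Qed.

Lemma inner_rows P a b : inner_interval P a b ->
  [/\ hrow P a (b.1, a.2), hrow P b (a.1, b.2),
      vcol P a (a.1, b.2) & vcol P b (b.1, a.2)].
Proof.
move=> [h1 [h2 h]]; split; split=> //= x hx; rewrite /hedge /vedge.
- by rewrite h //=; plia.
- by rewrite (h (x, b.2 - 1)) ?orbT //=; plia.
- by rewrite h //=; plia.
- by rewrite (h (b.1 - 1, x)) ?orbT //=; plia.
Qed.

Lemma eqv_counts P u w : eqv P u w ->
  forall p, hcount P p u = hcount P p w /\ vcount P p u = vcount P p w.
Proof.
elim=> {u w} [u w /permP h|a b u /inner_rows[h1 h2 h3 h4]|u w _ h|w u t _ h1 _ h2] p.
- by rewrite /hcount /vcount !h.
- rewrite /hcount /vcount /= (hrow_asb p h1) (hrow_asb p h2) (vcol_asb p h3) (vcol_asb p h4).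
  by split; lia.
- by have [-> ->] := h p.
- by have [-> ->] := h1 p; have [-> ->] := h2 p.
Qed.

Lemma match_rows P u w : (forall p, hcount P p u = hcount P p w) ->
  exists s, [/\ map fst s = u, perm_eq (map snd s) w & forall q, q \in s -> hrow P q.1 q.2].
Proof.
elim: u w => [|e u IH] w h.
  exists [::]; split=> //; case: w h => // x w /(_ x).
  by rewrite /hcount /=; have /asbP -> := hrow_refl P x.
have : (0 < hcount P e w)%N by rewrite -h /hcount /=; have /asbP -> := hrow_refl P e.
rewrite -has_count => /hasP[f fw /asbP ef].
have pw := perm_to_rem fw.
have [|s [h1 h2 h3]] := IH (rem f w).
  move=> p; have := h p; rewrite /hcount /= (permP pw) /= (hrow_asb p ef); plia.
exists ((e, f) :: s); split=> [||q] /=; first by rewrite h1.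
  by rewrite perm_sym; apply: (perm_trans pw); rewrite perm_cons perm_sym.
by rewrite inE => /predU1P[->|/h3].
Qed.

(** By the balance of columns, some pair starts on the column where the path ends. If it lies on the
    path, a cycle closes; otherwise it prolongs the path and [r] shrinks. *)
Lemma extract_cycle P x t r : path (link P) x t ->
  (forall p, vcount P p (map fst ((x :: t) ++ r)) = vcount P p (map snd ((x :: t) ++ r))) ->
  exists c r', [/\ perm_eq ((x :: t) ++ r) (c ++ r'), c != [::] & cycle (link P) c].
Proof.
have [n] := ubnP (size r); elim: n t r => // n IH t r sz pt bal.
have : has (fun p => asb (vcol P (last x t).2 p)) (map fst ((x :: t) ++ r)).
  rewrite has_count; have := bal (last x t).2; rewrite /vcount => ->.
  rewrite -has_count has_map; apply/hasP; exists (last x t).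
    by rewrite mem_cat mem_last.
  by apply/asbP; apply: vcol_refl.
rewrite has_map => /hasP[q]; rewrite mem_cat => /orP[qt|qr] lq.
  have : sorted (link P) (x :: t) by [].
  have : last x (x :: t) = last x t by [].
  case/splitPr: qt => s1 s2 el.
  move/cat_sorted2 => [_ /= ps].
  exists (q :: s2), (s1 ++ r); split=> //=.
    by rewrite -catA perm_catCA.
  by rewrite rcons_path ps; move: el lq; rewrite last_cat /= => <-.
have pr := perm_to_rem qr.
have pe : perm_eq ((x :: t) ++ r) ((x :: rcons t q) ++ rem q r).
  by rewrite -rcons_cons cat_rcons perm_cat2l.
have [|||c [r' [h1 h2 h3]]] := IH (rcons t q) (rem q r).
- by rewrite size_rem //; case: (r) sz qr.
- by rewrite rcons_path pt.
- by move=> p; rewrite /vcount -!(permP (perm_map _ pe)); apply: bal.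
- by exists c, r'; split=> //; apply: perm_trans pe h1.
Qed.

(** Closed walks are peeled off one at a time; the remainder stays balanced because counts are
    invariant under [eqv]. *)
Lemma balanced_eqv P s : is_simple P -> (forall q, q \in s -> hrow P q.1 q.2) ->
  (forall p, vcount P p (map fst s) = vcount P p (map snd s)) ->
  eqv P (map fst s) (map snd s).
Proof.
move=> simP; have [n] := ubnP (size s); elim: n s => // n IH [|x r] sz hr bal.
  exact: eqv_refl.
have [c [r' [pe c0 cyc]]] := extract_cycle (t := [::]) isT bal.
have /= {}pe : perm_eq (x :: r) (c ++ r') := pe.
have wc : closed_walk P c.
  by split=> // q qc; apply: hr; rewrite (perm_mem pe) mem_cat qc.
have ec := closed_walk_eqv simP wc.
have er : eqv P (map fst r') (map snd r').
  apply: IH => [|q qr|p].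
  - have := perm_size pe; move: sz; rewrite size_cat /=; case: (c) c0 => //= ? ? _; lia.
  - by apply: hr; rewrite (perm_mem pe) mem_cat qr orbT.
  - have := bal p; rewrite /vcount !(permP (perm_map _ pe)) !map_cat !count_cat.
    by have [_] := eqv_counts ec p; rewrite /vcount => -> /addnI.
apply: (eqv_trans (eqv_perm P (perm_map fst pe))).
rewrite map_cat; apply: (eqv_trans (eqv_cat ec er)); rewrite -map_cat.
by apply: eqv_perm; rewrite perm_sym; apply: (perm_map snd pe).
Qed.

(* The numbers of letters on the maximal edge intervals are a complete
   invariant: K[P] is a toric ring, whence cancellation. *)
Lemma counts_eqv P u w : is_simple P ->
  (forall p, hcount P p u = hcount P p w /\ vcount P p u = vcount P p w) -> eqv P u w.
Proof.
move=> simP h; have [|s [h1 h2 h3]] := match_rows (P := P) (u := u) (w := w).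
  by move=> p; have [] := h p.
apply: (eqv_trans (w := map snd s)); last exact: eqv_perm.
rewrite -h1; apply: balanced_eqv => // p.
by have [_] := h p; rewrite -h1 /vcount (permP h2).
Qed.

Lemma simple_cancel P v u w : is_simple P -> eqv P (v :: u) (v :: w) -> eqv P u w.
Proof.
move=> simP /eqv_counts h; apply: counts_eqv => // p.
by have [/addnI ? /addnI ?] := h p.
Qed.

(** * Vertices shared by two components are cut points *)

(** A separation encoded as a two-colouring of cells that can change only through [v]; unlike a
    statement on paths, it restricts at once to subcollections. *)
Definition cut (P : {fset pt2}) (v c d : pt2) : Prop :=
  exists g : pt2 -> bool, g c != g d /\
    forall c' d' w, c' \in P -> d' \in P -> w \in cverts c' -> w \in cverts d' ->
      w != v -> g c' = g d'.

(* The steps of a path of cells that cross the horizontal ray issued from p to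
   the right; their parity is the winding number of the path around p. *)
Definition crosses (p c d : pt2) : bool :=
  [&& c.1 == d.1, p.1 <= c.1 &
     (c.2 + 1 == d.2) && (d.2 == p.2) || (d.2 + 1 == c.2) && (c.2 == p.2)].

Fixpoint crossing (p c : pt2) (s : seq pt2) : bool :=
  if s is d :: s' then crosses p c d (+) crossing p d s' else false.

Definition on_right (p c : pt2) : bool := (c.2 == p.2) && (p.1 <= c.1).

(** The two rays differ by the edge from (x, y) to (x + 1, y). A path outside [P] never crosses it,
    as one of the two cells along it is in [P]. *)
Lemma crossing_hedge P x y c s : hedge P x y -> c \notin P ->
  all (fun d => d \notin P) s -> path share_edge c s ->
  crossing (x, y) c s = crossing (x + 1, y) c s.
Proof.
move=> hP; elim: s c => //= d s IH c cP /andP[dP sP] /andP[]; rewrite share_edgeE => hcd ps.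
rewrite (IH d) //; congr (_ (+) _); move: cP dP hP hcd; rewrite /crosses /hedge.
case: c d {ps IH} => [c1 c2] [d1 d2] /= cP dP hP hcd.
have [ex|nx] := eqVneq c1 x; last by rewrite (_ : (x <= c1) = (x + 1 <= c1)) //; plia.
rewrite (_ : (x + 1 <= c1) = false) ?andbF; last by plia.
apply/negP => /and3P[/eqP e1 _ e2].
move: hP; rewrite -ex; case/orP: e2 => /andP[/eqP e3 /eqP e4].
- by rewrite -e4 -{2}e3 addrK (negPf cP) [in (c1, _)]e1 (negPf dP).
- by rewrite -e4 -{2}e3 addrK (negPf cP) [in (c1, _)]e1 (negPf dP).
Qed.

(** The two rays bound the half-row [on_right], whose short end is an edge of [P] and cannot be
    crossed. Hence every crossing of a ray enters or leaves the half-row. *)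
Lemma crossing_vedge P x y c s : vedge P x y -> c \notin P ->
  all (fun d => d \notin P) s -> path share_edge c s ->
  crossing (x, y) c s (+) crossing (x, y + 1) c s =
  on_right (x, y) c (+) on_right (x, y) (last c s).
Proof.
move=> hP; elim: s c => [|d s IH] c /=; first by rewrite addbb.
move=> cP /andP[dP sP] /andP[]; rewrite share_edgeE => hcd ps.
rewrite addbACA (IH d) // addbA; congr (_ (+) _).
suff -> : crosses (x, y) c d (+) crosses (x, y + 1) c d =
   on_right (x, y) c (+) on_right (x, y) d by rewrite -addbA addbb addbF.
move: cP dP hP hcd; rewrite /crosses /on_right /vedge.
case: c d {ps IH} => [c1 c2] [d1 d2] /= cP dP hP.
case/orP=> /andP[/eqP ed]; rewrite -ed; move: dP; rewrite -ed => dP.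
  by case/orP=> /eqP <-; plia.
have n1 : ~~ ((c2 == y) && ((c1 == x) || (c1 == x - 1)) &&
              ((d1 == x) || (d1 == x - 1)) && (c1 != d1)).
  apply/negP => /andP[/andP[/andP[/eqP ey /orP[]/eqP e1] /orP[]/eqP e2] e3].
  - by rewrite e1 e2 eqxx in e3.
  - by move: hP cP dP; rewrite ey e1 e2 => /orP[] ->.
  - by move: hP cP dP; rewrite ey e1 e2 => /orP[] ->.
  - by rewrite e1 e2 eqxx in e3.
move=> hd; rewrite (_ : (c1 == d1) = false) /=; last by plia.
case: (eqVneq c2 y) n1 => //= _ n1; rewrite (_ : (x <= c1) = (x <= d1)) ?addbb //.
by plia.
Qed.

Lemma addb_eq (x y : bool) : x (+) y = false -> x = y.
Proof. by case: x y => [] []. Qed.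

Lemma on_right_parity (a b e e' x y : int) :
  (e == a - 1) && (e' == a) || (e == a) && (e' == a - 1) ->
  on_right (x, y) (e, b) (+) on_right (x, y) (e', b - 1) (+)
    ((y == b) && (x <= e) (+) (y + 1 == b) && (x <= e)) = (x == a) && (y == b - 1).
Proof.
rewrite /on_right /=; have [->|ny] := eqVneq y b.
  have -> : (b - 1 == b) = false by lia.
  have -> : (b + 1 == b) = false by lia.
  have -> : (b == b - 1) = false by lia.
  by rewrite /= addbF addbb andbF.
have -> : (y + 1 == b) = (y == b - 1) by lia.
rewrite /= [b - 1 == y]eq_sym.
by have [ey|ny'] := eqVneq y (b - 1); rewrite /= ?andbT ?andbF //; lia.
Qed.

(** [g] is the winding parity, around each vertex, of a path outside [P] from (e, b) to (e', b - 1)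
    closed up through (e, b - 1). Along edges of [P] it changes only where the two closing steps
    cross. *)
Lemma flip_potential P (a b e e' : int) : is_simple P ->
  (e == a - 1) && (e' == a) || (e == a) && (e' == a - 1) ->
  (e, b) \notin P -> (e', b - 1) \notin P ->
  exists g : pt2 -> bool,
    (forall x y, hedge P x y -> g (x, y) (+) g (x + 1, y) = (x == e) && (y == b)) /\
    (forall x y, vedge P x y -> g (x, y) (+) g (x, y + 1) = (x == a) && (y == b - 1)).
Proof.
move=> simP he n1 n2; have [s [sP [ps ls]]] := simP _ _ n1 n2.
(* The second term accounts for the closing step between (e, b - 1) and (e, b); the other closing
   step is horizontal and crosses no ray. *)
exists (fun p => crossing p (e, b) s (+) ((p.2 == b) && (p.1 <= e))); split=> x y h.
  rewrite (crossing_hedge h n1 sP ps) addbACA addbb /= {he}; plia.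
by rewrite addbACA (crossing_vedge h n1 sP ps) ls /=; apply: on_right_parity.
Qed.

(* The loop formed by a path outside P between the two cells missing at the
   vertex, closed up through the cell (e, b - 1), separates the two others. *)
Lemma cut_corner P (a b e e' : int) : is_simple P ->
  (e == a - 1) && (e' == a) || (e == a) && (e' == a - 1) ->
  (e, b) \notin P -> (e', b - 1) \notin P -> (e, b - 1) \in P -> (e', b) \in P ->
  cut P (a, b) (e, b - 1) (e', b).
Proof.
move=> simP he n1 n2 p1 p2.
have [g0 [hflip vflip]] := flip_potential simP he n1 n2.
(* Both flipped edges end at (a, b), so they do not separate the other corners of a cell of [P]. *)
have cell c w w' : c \in P -> w \in cverts c -> w' \in cverts c ->
    w != (a, b) -> w' != (a, b) -> g0 w = g0 w'.
  move=> cP; have base u : u \in cverts c -> u != (a, b) -> g0 u = g0 (c.1 + 1, c.2).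
    case: c cP => x y cP; rewrite mem_cverts; case: u => u1 u2 /= hu uv.
    have hB : g0 (x, y) = g0 (x + 1, y).
      apply: addb_eq; rewrite hflip /hedge ?cP //; apply/negP => /andP[/eqP ex /eqP ey].
      by move: n1; rewrite -ex -ey cP.
    case/andP: hu => /orP[]/eqP eu1 /orP[]/eqP eu2; move: uv; rewrite eu1 eu2 => // uv.
    - rewrite -hB; apply/esym/addb_eq; rewrite vflip /vedge ?cP //.
      by apply: contraNF uv => /andP[/eqP -> /eqP ->]; rewrite subrK.
    - apply/esym/addb_eq; rewrite vflip /vedge ?addrK ?cP ?orbT //.
      by apply: contraNF uv => /andP[/eqP -> /eqP ->]; rewrite subrK.
  by move=> wc w'c wv w'v; rewrite (base w) // (base w').
(* [r c] is a corner of [c] other than the cut point; its value colours the cell. *)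
pose r c : pt2 := if c == (a, b) then (a + 1, b) else c.
have rP c : r c \in cverts c /\ r c != (a, b).
  rewrite /r; case: eqP => [->|/eqP ?]; last by split=> //; apply: mem_head.
  by rewrite /cverts !inE eqxx orbT xpair_eqE (_ : (a + 1 == a) = false) //; clear; lia.
exists (g0 \o r); split=> [|c' d' w] /=; last first.
  move=> c'P d'P wc wd wv; have [? ?] := rP c'; have [? ?] := rP d'.
  by rewrite (cell c' (r c') w) // (cell d' w (r d')).
(* This edge is flipped, and each of the two cells has the value at one of its ends. *)
have hv : g0 (a, b - 1) != g0 (a, b).
  have := vflip a (b - 1); rewrite subrK !eqxx /vedge -negb_eqb => -> //.
  by case/orP: he => /andP[/eqP <- _]; rewrite p1 ?orbT.
have h1 : g0 (r (e, b - 1)) = g0 (a, b - 1).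
  rewrite /r xpair_eqE (_ : (b - 1 == b) = false) ?andbF; last by clear; lia.
  case/orP: he => /andP[/eqP ee /eqP ee']; last by rewrite ee.
  apply: addb_eq; rewrite ee -{2}[a](subrK 1) hflip; first by clear; lia.
  by rewrite /hedge -ee p1.
have h2 : g0 (r (e', b)) = g0 (a, b).
  rewrite /r xpair_eqE eqxx andbT; case/orP: he => /andP[/eqP ee /eqP ee'].
    rewrite ee' eqxx; apply/esym/addb_eq; rewrite hflip ?ee; first by clear; lia.
    by rewrite /hedge -ee' p2.
  rewrite ee' (_ : (a - 1 == a) = false); last by clear; lia.
  apply: addb_eq; rewrite -{2}[a](subrK 1) hflip ?ee; first by clear; lia.
  by rewrite /hedge -ee' p2.
by rewrite h1 h2.
Qed.

(** * The Hilbert function counts switching classes *)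

Lemma mem_VS P p : (p \in VS P) = has (fun c => p \in cverts c) P.
Proof.
rewrite /VS mem_undup; apply/flattenP/hasP => [[s /mapP[c cP ->] ps]|[c cP pc]].
  by exists c.
by exists (cverts c) => //; apply: map_f.
Qed.

Definition inV P (u : seq pt2) : bool := all (fun p => p \in VS P) u.

Lemma mem_VS_cell P c p : c \in P -> p \in cverts c -> p \in VS P.
Proof. by move=> cP pc; rewrite mem_VS; apply/hasP; exists c. Qed.

Lemma corners_VS P a b : inner_interval P a b ->
  [/\ a \in VS P, b \in VS P, (a.1, b.2) \in VS P & (b.1, a.2) \in VS P].
Proof.
case: a b => [x y] [x' y'] [/= h1 [h2 h]].
by split; [apply: (@mem_VS_cell _ (x, y)) | apply: (@mem_VS_cell _ (x' - 1, y' - 1))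
  | apply: (@mem_VS_cell _ (x, y' - 1)) | apply: (@mem_VS_cell _ (x' - 1, y))];
  rewrite ?h ?mem_cverts /= ?subrK ?eqxx ?orbT //; lia.
Qed.

Section Monomials.
Variables (K : fieldType) (P : {fset pt2}).

Definition mon (u : seq pt2) : SP K P := \prod_(p <- u) xv K P p.

Definition vtx (i : 'I_(nV P)) : pt2 := nth (0, 0) (VS P) i.

Definition expo (u : seq pt2) : 'X_{1..nV P} := [multinom count_mem (vtx i) u | i < nV P].

Definition word (m : 'X_{1..nV P}) : seq pt2 :=
  flatten [seq nseq (m i) (vtx i) | i <- index_enum 'I_(nV P)].

Lemma vtx_size (i : 'I_(nV P)) : (i < size (VS P))%N.
Proof. exact: ltn_ord. Qed.

Lemma vtx_inj : injective vtx.
Proof.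
by move=> i j /eqP; rewrite /vtx nth_uniq ?undup_uniq ?vtx_size // => /eqP/val_inj.
Qed.

Lemma vtxP p : p \in VS P -> exists i, p = vtx i.
Proof. by move=> /(nthP (0, 0))[i hi <-]; exists (Ordinal hi). Qed.

Lemma vtx_VS i : vtx i \in VS P.
Proof. by apply: mem_nth; apply: vtx_size. Qed.

Lemma xv_vtx i : xv K P (vtx i) = 'X_i.
Proof.
by rewrite /xv /vtx index_uniq ?undup_uniq ?vtx_size // valK.
Qed.

Lemma mon_expo u : inV P u -> mon u = 'X_[expo u].
Proof.
elim: u => [|p u IH] /=.
  move=> _; rewrite /mon big_nil -mpolyX0; congr ('X_[_]).
case/andP=> /vtxP[i ->] /IH e; rewrite /mon big_cons -/(mon u) e xv_vtx -mpolyXD.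
congr ('X_[_]); apply/mnmP => j; rewrite mnmDE mnm1E !mnmE /=.
by rewrite (inj_eq vtx_inj).
Qed.

Lemma count_word m i : count_mem (vtx i) (word m) = m i.
Proof.
rewrite /word count_flatten sumnE !big_map /= (bigD1 i) //= big1 => [|j ji].
  by rewrite count_nseq /= eqxx mul1n addn0.
by rewrite count_nseq /= (inj_eq vtx_inj) (negPf ji).
Qed.

Lemma word_inV m : inV P (word m).
Proof. by apply/allP => p /flattenP[s /mapP[i _ ->] /nseqP[-> _]]; apply: vtx_VS. Qed.

Lemma expo_word m : expo (word m) = m.
Proof. by apply/mnmP => i; rewrite mnmE count_word. Qed.

Lemma mon_word m : mon (word m) = 'X_[m].
Proof. by rewrite mon_expo ?word_inV // expo_word. Qed.

Lemma word_expo u : inV P u -> perm_eq (word (expo u)) u.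
Proof.
move=> uV; apply/allP => p; rewrite mem_cat => pu; apply/eqP => /=.
have /vtxP[i ->] : p \in VS P.
  by case/orP: pu => [/(allP (word_inV _))|/(allP uV)].
by rewrite count_word mnmE.
Qed.

Lemma size_word m : size (word m) = mdeg m.
Proof.
rewrite /word size_flatten sumnE mdegE !big_map /=.
by apply: eq_bigr => i _; rewrite size_nseq.
Qed.

Lemma in_IP0 : in_IP (0 : SP K P).
Proof. by exists [::]; split=> //; rewrite big_nil. Qed.

Lemma in_IPD p q : in_IP p -> in_IP q -> in_IP (p + q : SP K P).
Proof.
move=> [s [hs ->]] [t [ht ->]]; exists (s ++ t); split; last by rewrite big_cat.
by move=> x; rewrite mem_cat => /orP[/hs|/ht].
Qed.

Lemma in_IPM p q : in_IP q -> in_IP (p * q : SP K P).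
Proof.
move=> [s [hs ->]]; exists [seq (p * x.1, x.2) | x <- s]; split.
  by move=> _ /mapP[x /hs h ->].
by rewrite big_map mulr_sumr; apply: eq_bigr => x _ /=; rewrite mulrA.
Qed.

Lemma in_IPZ c q : in_IP q -> in_IP (c *: q : SP K P).
Proof. by rewrite -mul_mpolyC; apply: in_IPM. Qed.

Lemma in_IP_sum (I : Type) (r : seq I) (F : I -> SP K P) :
  (forall i, in_IP (F i)) -> in_IP (\sum_(i <- r) F i).
Proof. by move=> h; apply: big_ind => //; [apply: in_IP0 | apply: in_IPD]. Qed.

Lemma mon_perm u w : perm_eq u w -> mon u = mon w.
Proof. by move=> h; apply: perm_big. Qed.

Lemma mon_move a b u :
  mon [:: a, b & u] - mon [:: (a.1, b.2), (b.1, a.2) & u] = mon u * minor2 K P a b.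
Proof. by rewrite /mon !big_cons /minor2 !mulrA -mulrBl mulrC. Qed.

Lemma eqv_IP u w : eqv P u w -> in_IP (mon u - mon w).
Proof.
elim=> {u w} [u w /mon_perm ->|a b u h|u w _ h|w u t _ h1 _ h2].
- by rewrite subrr; apply: in_IP0.
- rewrite mon_move; exists [:: (mon u, (a, b))]; split; last by rewrite big_seq1.
  by move=> x; rewrite inE => /eqP ->.
- by rewrite -opprB -scaleN1r; apply: in_IPZ.
- by rewrite -[mon u](subrK (mon w)) -addrA; apply: in_IPD.
Qed.

Definition deg_word (k : nat) (u : seq pt2) : Prop := size u = k /\ inV P u.

(* The linear form on S_P that reads off the coordinate of the class of t in
   K[P]; truncating at degree k makes the sum finite. *)
Definition class_sum (k : nat) (t : seq pt2) (p : SP K P) : K :=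
  \sum_(m : 'X_{1..(nV P) < k.+1}) p@_m * (asb (eqv P (word m) t))%:R.

Lemma class_sumD k t p q : class_sum k t (p + q) = class_sum k t p + class_sum k t q.
Proof. by rewrite -big_split; apply: eq_bigr => m _; rewrite mcoeffD mulrDl. Qed.

Lemma class_sumZ k t c p : class_sum k t (c *: p) = c * class_sum k t p.
Proof. by rewrite mulr_sumr; apply: eq_bigr => m _; rewrite mcoeffZ mulrA. Qed.

Lemma class_sum_sum k t (I : Type) (r : seq I) (F : I -> SP K P) :
  class_sum k t (\sum_(i <- r) F i) = \sum_(i <- r) class_sum k t (F i).
Proof.
elim: r => [|i r IH]; last by rewrite !big_cons class_sumD IH.
by rewrite !big_nil /class_sum big1 // => m _; rewrite mcoeff0 mul0r.
Qed.

Lemma class_sum_mon k t u : size t = k -> inV P u ->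
  class_sum k t (mon u) = (asb (eqv P u t))%:R.
Proof.
move=> st uV; rewrite mon_expo // /class_sum.
have e : asb (eqv P (word (expo u)) t) = asb (eqv P u t).
  have h := eqv_perm P (word_expo uV).
  apply/asbP/asbP => h'; [apply: eqv_trans h' | apply: eqv_trans h h'].
  exact: eqv_sym.
case: (ltnP (mdeg (expo u)) k.+1) => hk.
  pose b : 'X_{1..(nV P) < k.+1} := BMultinom hk.
  rewrite (bigD1 b) //= mcoeffX eqxx mul1r e big1 ?addr0 // => m hm.
  rewrite mcoeffX [_ == _](negPf _) ?mul0r //.
  by apply: contraNneq hm => hm; apply/eqP/val_inj.
(* Beyond the truncation both sides vanish: [u] has more than [k] letters and is not equivalent to
   [t]. *)
rewrite big1 => [|m _].
  case: asbP => // /eqv_size; rewrite -(perm_size (word_expo uV)) size_word st => e'.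
  by rewrite e' ltnn in hk.
rewrite mcoeffX (_ : _ == _ = false) ?mul0r //.
by apply: contraTF hk => /eqP ->; rewrite -ltnNge bmdeg.
Qed.

(** By linearity a monomial multiple of a minor suffices, and its two monomials are equivalent. *)
Lemma class_sum_IP k t p : size t = k -> in_IP p -> class_sum k t p = 0.
Proof.
move=> st [s [hs ->]]; rewrite class_sum_sum big1_seq // => x /andP[_ /hs hx].
rewrite [x.1]mpolyE mulr_suml class_sum_sum big1 // => m _.
rewrite -scalerAl class_sumZ -mon_word -mon_move class_sumD -scaleN1r class_sumZ.
have [h1 h2 h3 h4] := corners_VS hx.
rewrite !class_sum_mon //= ?h1 ?h2 ?h3 ?h4 ?word_inV //.
rewrite (_ : asb (eqv P _ _) = asb (eqv P [:: (x.2.1.1, x.2.2.2), (x.2.2.1, x.2.1.2) & word m] t)).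
  by rewrite mulN1r subrr mulr0.
have h := eqv_move (word m) hx.
by apply/asbP/asbP => h'; apply: eqv_trans h' => //; apply: eqv_sym.
Qed.

Definition class_reps (ok : seq pt2 -> Prop) (n : nat) (t : 'I_n -> seq pt2) : Prop :=
  [/\ forall i, ok (t i), forall i j, eqv P (t i) (t j) -> i = j
    & forall u, ok u -> exists i, eqv P u (t i)].

(** The monomials at the representatives form a basis in degree [k], with the functionals
    [class_sum] as dual basis. *)
Lemma class_reps_hilb_dim k n (t : 'I_n -> seq pt2) :
  class_reps (deg_word k) t -> hilb_dim K P k n.
Proof.
move=> [t1 t2 t3]; have st i : size (t i) = k by have [] := t1 i.
have tV i : inV P (t i) by have [] := t1 i.
have csE i j : class_sum k (t j) (mon (t i)) = (i == j)%:R.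
  rewrite class_sum_mon //; congr (_%:R); congr nat_of_bool.
  by apply/asbP/eqP => [/t2 //|->]; apply: eqv_refl.
split.
  exists (fun i => mon (t i)); split.
    by move=> i; rewrite mon_expo // dhomogX /= -size_word (perm_size (word_expo _)) ?st.
  move=> c /(class_sum_IP (st _)) hc i; have := hc i.
  rewrite class_sum_sum (bigD1 i) //= big1 => [|j ji].
    by rewrite class_sumZ csE eqxx mulr1 addr0.
  by rewrite class_sumZ csE (negPf ji) mulr0.
move=> f [fhom find].
pose A : 'M[K]_(n.+1, n) := \matrix_(i, j) class_sum k (t j) (f i).
have : kermx A != 0.
  by rewrite kermx_eq0 /row_free neq_ltn ltnS rank_leq_col.
case/rowV0Pn => c /sub_kermxP cA c0.
have : in_IP (\sum_(i < n.+1) c 0 i *: f i).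
  set p := \sum_(i < _) _.
  have phom : p \is k.-homog by apply: rpred_sum => i _; apply: rpredZ.
  have pdeg m : m \in msupp p -> mdeg m = k by move/dhomogP: phom; apply.
  have p0 j : class_sum k (t j) p = 0.
    rewrite class_sum_sum; have e : (c *m A) 0 j = 0 by rewrite cA mxE.
    rewrite mxE in e; rewrite -[RHS]e; apply: eq_bigr => i _.
    by rewrite class_sumZ mxE.
  (* All class sums of [p] vanish, so subtracting from each monomial its representative changes
     nothing and exhibits [p] as a combination of differences of equivalent monomials. *)
  have -> : p = \sum_(m : 'X_{1..(nV P) < k.+1})
      p@_m *: ('X_[m] - \sum_(j < n) (asb (eqv P (word m) (t j)))%:R *: mon (t j)).
    rewrite (eq_bigr (fun m : 'X_{1..(nV P) < k.+1} => p@_m *: 'X_[m] -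
        \sum_(j < n) (p@_m * (asb (eqv P (word m) (t j)))%:R) *: mon (t j))); last first.
      move=> m _; rewrite scalerBr scaler_sumr; congr (_ - _).
      by apply: eq_bigr => j _; rewrite scalerA.
    rewrite sumrB exchange_big /= [X in _ - X]big1 ?subr0 => [|j _]; last first.
      by rewrite -scaler_suml -/(class_sum k (t j) p) p0 scale0r.
    apply: mpolywE; rewrite msizeE; apply/bigmax_leqP_seq => m mp _.
    by rewrite ltnS pdeg.
  apply: in_IP_sum => m; have [->|pm] := eqVneq p@_m 0.
    by rewrite scale0r; apply: in_IP0.
  have dm : mdeg m = k.
    by apply: pdeg; rewrite mcoeff_msupp.
  have [|j hj] := t3 (word m).
    by split; [rewrite size_word | apply: word_inV].
  apply: in_IPZ; rewrite (bigD1 j) //= big1 => [|i ij].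
    have /asbP -> := hj; rewrite scale1r addr0 -mon_word; exact: eqv_IP.
  case: asbP => [h|_]; last by rewrite scale0r.
  by rewrite (t2 i j) ?eqxx // in ij; apply: eqv_trans hj; apply: eqv_sym.
move/find => h; case/negP: c0; apply/eqP/rowP => i; by rewrite h mxE.
Qed.

End Monomials.

Lemma indep_mod_widen (K : fieldType) (P : {fset pt2}) k m n (le : (m <= n)%N)
    (f : 'I_n -> SP K P) :
  indep_mod k f -> indep_mod k (fun i : 'I_m => f (widen_ord le i)).
Proof.
move=> [h1 h2]; split=> [i|c hc i]; first exact: h1.
pose c' (j : 'I_n) : K := oapp c 0 (insub (j : nat)).
have c'E (j : 'I_m) : c' (widen_ord le j) = c j.
  by rewrite /c' /= insubT ?ltn_ord //= => h; congr c; apply: val_inj.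
rewrite -c'E; apply: h2; suff -> : \sum_(j < n) c' j *: f j =
   \sum_(j < m) c j *: f (widen_ord le j) by [].
rewrite (bigID (fun j : 'I_n => (j < m)%N)) /= [X in _ + X]big1 ?addr0 => [|j hj].
  by rewrite (big_ord_narrow le); apply: eq_bigr => j _; rewrite c'E.
by rewrite /c' insubF ?scale0r //; apply/negbTE.
Qed.

Lemma hilb_dim_inj (K : fieldType) P k m n :
  hilb_dim K P k m -> hilb_dim K P k n -> m = n.
Proof.
move=> [[f hf] nf] [[g hg] ng]; case: (ltngtP m n) => // h.
  by case: (nf _ (indep_mod_widen h hg)).
by case: (ng _ (indep_mod_widen h hf)).
Qed.

Lemma finite_class_reps P (ok : seq pt2 -> Prop) (l : seq (seq pt2)) :
  (forall u, ok u -> u \in l) ->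
  exists n (t : 'I_n -> seq pt2), class_reps P ok t.
Proof.
move=> okl.
have [s [s1 s2 s3]] : exists s, [/\ forall u, u \in s -> ok u,
    pairwise (fun a b => ~~ asb (eqv P a b)) s &
    forall u, u \in l -> ok u -> exists2 a, a \in s & eqv P u a].
  elim: l {okl} => [|x l [s [s1 s2 s3]]]; first by exists [::].
  case: (excluded_middle_informative (ok x /\ forall a, a \in s -> ~ eqv P x a)) => h.
    exists (x :: s); split=> /=.
    - by move=> u; rewrite inE => /predU1P[->|/s1 //]; case: h.
    - rewrite s2 andbT; apply/allP => a /(proj2 h) na; exact/asbP.
    - move=> u; rewrite inE => /predU1P[-> _|ul /(s3 _ ul)[a a1 a2]].
        by exists x; [apply: mem_head | apply: eqv_refl].
      by exists a => //; rewrite inE a1 orbT.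
  exists s; split=> // u; rewrite inE => /predU1P[-> okx|/s3 //].
  apply: NNPP => nE; apply: h; split=> // a a1 a2; apply: nE; by exists a.
exists (size s), (fun i => nth [::] s i); split=> [i|i j|u hu].
- by apply: s1; apply: mem_nth.
- move/pairwiseP: s2 => /(_ [::]) s2 h; apply/val_inj => /=.
  case: (ltngtP i j) => // lt; have := s2 _ _ _ _ lt; rewrite !inE !ltn_ord => /(_ isT isT).
    by move/asbP.
  by move/asbP; case; apply: eqv_sym.
- have [a a1 a2] := s3 _ (okl _ hu) hu.
  have ha : (index a s < size s)%N by rewrite index_mem.
  by exists (Ordinal ha); rewrite /= nth_index.
Qed.

Fixpoint words (T : eqType) (l : seq T) (k : nat) : seq (seq T) :=
  if k is k'.+1 then [seq p :: w | p <- l, w <- words l k'] else [:: [::]].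

Lemma mem_words (T : eqType) (l : seq T) u : all (fun p => p \in l) u -> u \in words l (size u).
Proof.
elim: u => //= p u IH /andP[pl /IH ul]; apply/allpairsP.
by exists (p, u).
Qed.

(** * Gluing at a vertex *)

Lemma eqv_sub A P u w : (forall a b, inner_interval A a b -> inner_interval P a b) ->
  eqv A u w -> eqv P u w.
Proof.
move=> h; elim=> {u w} [u w|a b u /h|u w _|w u t _ h1 _ h2].
- exact: eqv_perm.
- exact: eqv_move.
- exact: eqv_sym.
- exact: eqv_trans h1 h2.
Qed.

Definition retract (V : pred pt2) (v p : pt2) : pt2 := if V p then p else v.

(** A switch either survives in [A] or has all four corners sent to [v] and becomes trivial. *)
Lemma eqv_retract P A V v u w :
  (forall a b, inner_interval P a b ->
     let cs := [:: a; b; (a.1, b.2); (b.1, a.2)] in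
     inner_interval A a b /\ all V cs \/ {in cs, forall p, retract V v p = v}) ->
  eqv P u w -> eqv A (map (retract V v) u) (map (retract V v) w).
Proof.
move=> h; elim=> {u w} [u w e|a b u /h /= []|u w _|w u t _ h1 _ h2].
- by apply: eqv_perm; apply: perm_map.
- move=> [i /and5P[h1 h2 h3 h4 _]].
  by rewrite /retract h1 h2 h3 h4; apply: eqv_move.
- move=> e; rewrite !e ?inE ?eqxx ?orbT //; exact: eqv_refl.
- exact: eqv_sym.
- exact: eqv_trans h1 h2.
Qed.

Lemma retract_id (V : pred pt2) v u : all V u -> map (retract V v) u = u.
Proof.
by move=> /allP h; apply: map_id_in => p /h pV; rewrite /retract pV.
Qed.

Lemma retract_const (V : pred pt2) v u : (forall p, p \in u -> V p -> p = v) ->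
  map (retract V v) u = nseq (size u) v.
Proof.
elim: u => //= p u IH h; rewrite IH => [|q qu]; last by apply: h; rewrite inE qu orbT.
by congr (_ :: _); rewrite /retract; case: ifP => // /h; apply; apply: mem_head.
Qed.

(** The monomials whose class in K[B] is not divisible by x_v; their classes form a basis of
    K[B]/(x_v). *)
Definition prim_word B (v : pt2) (k : nat) (u : seq pt2) : Prop :=
  deg_word B k u /\ forall w, inV B w -> ~ eqv B u (v :: w).

Definition cancellable A (V : pred pt2) (v : pt2) : Prop :=
  forall u w, all V u -> all V w -> eqv A (v :: u) (v :: w) -> eqv A u w.

Lemma cancel_nseq A V v n u w : cancellable A V v -> V v -> all V u -> all V w ->
  eqv A (nseq n v ++ u) (nseq n v ++ w) -> eqv A u w.
Proof.
move=> cA vV uV wV; elim: n => //= n IH /cA h; apply: IH; apply: h;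
  by rewrite all_cat ?uV ?wV andbT; apply/allP => p /nseqP[->].
Qed.

Lemma prim_decomposition B v u : v \in VS B -> inV B u ->
  exists m w, prim_word B v (size u - m) w /\ eqv B u (nseq m v ++ w) /\ (m <= size u)%N.
Proof.
move=> vB; have [n] := ubnP (size u); elim: n u => // n IH u sz uV.
case: (excluded_middle_informative (exists2 w, inV B w & eqv B u (v :: w))) => [[w wV h]|h].
  have e := eqv_size h; have [|m [x [h1 [h2 h3]]]] := IH w _ wV; first by rewrite e in sz.
  exists m.+1, x; rewrite e /= subSS; split=> //; split=> //.
  by apply: (eqv_trans h); apply: eqv_cons.
exists 0%N, u; rewrite subn0; split; last by split=> //; apply: eqv_refl.
by split=> // w wV hw; apply: h; exists w.
Qed.

(* V is the vertex set of A, kept separate from VS A so that A may be the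
   single vertex v, without cells: the lemma then says that the classes of B
   are uniquely a power of v times a class not divisible by v. *)
Section Glue.
Variables (A B P : {fset pt2}) (V : pred pt2) (v : pt2).
Hypothesis innerP : forall a b,
  inner_interval P a b <-> inner_interval A a b \/ inner_interval B a b.
Hypothesis innerA : forall a b, inner_interval A a b ->
  all V [:: a; b; (a.1, b.2); (b.1, a.2)].
Hypothesis VSP : forall p, (p \in VS P) = V p || (p \in VS B).
Hypothesis vA : V v.
Hypothesis vB : v \in VS B.
Hypothesis meet : forall p, V p -> p \in VS B -> p = v.

Local Notation VB := [pred p | p \in VS B].

Lemma innerB a b : inner_interval B a b -> all VB [:: a; b; (a.1, b.2); (b.1, a.2)].
Proof. by case/corners_VS=> h1 h2 h3 h4; rewrite /= h1 h2 h3 h4. Qed.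

Lemma eqv_retractA u w : eqv P u w -> eqv A (map (retract V v) u) (map (retract V v) w).
Proof.
apply: eqv_retract => a b /innerP[h|/innerB /allP h]; [left | right].
  by split=> //; apply: innerA.
by move=> p /h pB; rewrite /retract; case: ifP => // pV; apply: meet.
Qed.

Lemma eqv_retractB u w : eqv P u w -> eqv B (map (retract VB v) u) (map (retract VB v) w).
Proof.
apply: eqv_retract => a b /innerP[/innerA /allP h|h]; [right | left].
  by move=> p /h pV; rewrite /retract; case: ifP => // pB; apply: meet.
by split=> //; apply: innerB.
Qed.

Lemma eqvAP u w : eqv A u w -> eqv P u w.
Proof. by apply: eqv_sub => a b h; apply/innerP; left. Qed.

Lemma eqvBP u w : eqv B u w -> eqv P u w.
Proof. by apply: eqv_sub => a b h; apply/innerP; right. Qed.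

Hypothesis cancelA : cancellable A V v.
Hypothesis cancelB : cancellable B VB v.

(* Collapsing the letters of one side to v retracts the classes of P onto
   those of the other side. *)
Lemma glue_inj k k' a b a' b' : all V a -> all V a' ->
  prim_word B v k b -> prim_word B v k' b' ->
  eqv P (a ++ b) (a' ++ b') -> [/\ size a = size a', eqv A a a' & eqv B b b'].
Proof.
wlog le : k k' a b a' b' / (size a' <= size a)%N => [hw|] aV aV' pb pb' h.
  case: (leqP (size a') (size a)) => [le|/ltnW le]; first exact: (hw _ _ _ _ _ _ le aV aV' pb pb' h).
  have [e1 e2 e3] := hw _ _ _ _ _ _ le aV' aV pb' pb (eqv_sym h).
  by split=> //; apply: eqv_sym.
have [[sb bV] nb] := pb; have [[sb' bV'] nb'] := pb'.
have sVB u : all V u -> map (retract VB v) u = nseq (size u) v.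
  by move=> /allP uV; apply: retract_const => p /uV; apply: meet.
have sVA u : inV B u -> map (retract V v) u = nseq (size u) v.
  move=> /allP uV; apply: retract_const => p /uV pB pV; exact: meet.
have hB := eqv_retractB h; rewrite !map_cat (sVB _ aV) (sVB _ aV') in hB.
rewrite !(retract_id (V := VB)) // in hB.
have hA := eqv_retractA h; rewrite !map_cat (sVA _ bV) (sVA _ bV') in hA.
rewrite !retract_id // in hA.
have nV n u : inV B u -> inV B (nseq n v ++ u).
  by move=> uV; rewrite /inV all_cat [all _ u]uV andbT; apply/allP => p /nseqP[->].
rewrite -(subnKC le) nseqD -catA in hB.
have {}hB := cancel_nseq cancelB vB (nV (size a - size a')%N _ bV) bV' hB.
(* Otherwise [v] would divide the primitive word [b']. *)
have d0 : (size a - size a' = 0)%N.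
  case: (size a - size a')%N hB => // d /eqv_sym hB.
  by case: (nb' (nseq d v ++ b)) => //; apply: nV.
rewrite d0 /= in hB; have e : size a = size a' by lia.
split=> //; rewrite (eqv_size hB) in hA.
apply: (cancel_nseq (n := size b') cancelA vA aV aV').
apply: (eqv_trans (w := a ++ nseq (size b') v)); first by apply: eqv_perm; rewrite perm_catC.
by apply: (eqv_trans hA); apply: eqv_perm; rewrite perm_catC.
Qed.

Variables (nA nW : nat -> nat).
Variable tA : forall k, 'I_(nA k) -> seq pt2.
Variable tW : forall k, 'I_(nW k) -> seq pt2.
Hypothesis htA : forall k, class_reps A (fun u => size u = k /\ all V u) (tA (k := k)).
Hypothesis htW : forall k, class_reps B (prim_word B v k) (tW (k := k)).

Lemma glue_class_reps k :
  exists t : 'I_(\sum_(i < k.+1) nA i * nW (k - i)) -> seq pt2,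
    class_reps P (deg_word P k) t.
Proof.
pose I := {i : 'I_k.+1 & ('I_(nA i) * 'I_(nW (k - i)))%type}.
pose T (x : I) := tA (tagged x).1 ++ tW (tagged x).2.
have card : #|{: I}| = (\sum_(i < k.+1) nA i * nW (k - i))%N.
  rewrite card_tagged sumnE big_map big_enum /=.
  by apply: eq_bigr => i _; rewrite card_prod !card_ord.
have AV i x : size (@tA i x) = i /\ all V (@tA i x) by have [h _ _] := htA i.
have WV i x : prim_word B v i (@tW i x) by have [h _ _] := htW i.
rewrite -card; exists (fun x => T (enum_val x)); split=> [x|x y h|u [su uV]].
- case: (enum_val x) => i [a b]; rewrite /T /=; have [sa aV] := AV _ a.
  have [[sb bV] _] := WV _ b.
  split; first by rewrite size_cat sa sb subnKC // -ltnS.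
  rewrite /inV all_cat; apply/andP; split; apply/allP => p.
    by move/(allP aV); rewrite VSP => ->.
  by move/(allP bV); rewrite VSP => ->; rewrite orbT.
- apply: enum_val_inj; move: h; case: (enum_val x) (enum_val y) => i [a b] [j [a' b']].
  rewrite /T /= => h; have [e1 e2 e3] := glue_inj (proj2 (AV _ _)) (proj2 (AV _ _)) (WV _ _) (WV _ _) h.
  have ij : i = j by apply: val_inj => /=; rewrite -(proj1 (AV _ a)) e1 (proj1 (AV _ a')).
  move: a b a' b' e2 e3 {h e1}; rewrite -ij => a b a' b' e2 e3.
  have [_ iA _] := htA i; have [_ iW _] := htW (k - i).
  by rewrite (iA _ _ e2) (iW _ _ e3).
(* The letters outside [V] form a word of [B]; the power of [v] dividing it is moved to the A side,
   which leaves a primitive word. *)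
- pose u0 := filter V u; pose u1 := filter (predC V) u.
  have pu : perm_eq u (u0 ++ u1) by rewrite perm_sym; apply/permEl/perm_filterC.
  have u1V : inV B u1.
    apply/allP => p; rewrite mem_filter /= => /andP[np pu1].
    by have := allP uV _ pu1; rewrite VSP (negPf np).
  have [m [w [w1 [w2 w3]]]] := prim_decomposition vB u1V.
  have u0V : all V (u0 ++ nseq m v).
    by rewrite all_cat filter_all; apply/allP => p /nseqP[->].
  have sk : (size u0 + m + (size u1 - m) = k)%N.
    by rewrite -addnA subnKC // -size_cat -(perm_size pu).
  have lei : (size u0 + m < k.+1)%N by rewrite ltnS -sk leq_addr.
  pose i := Ordinal lei.
  have [_ _ cA] := htA i; have [_ _ cW] := htW (k - i).
  have [|a ha] := cA (u0 ++ nseq m v); first by rewrite size_cat size_nseq.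
  have [|b hb] := cW w.
    by rewrite (_ : (k - i)%N = (size u1 - m)%N) //= -sk addKn.
  pose x : I := Tagged (fun i : 'I_k.+1 => ('I_(nA i) * 'I_(nW (k - i)))%type) (a, b).
  exists (enum_rank x); rewrite enum_rankK /T /=.
  apply: (eqv_trans (eqv_perm P pu)).
  apply: (eqv_trans (eqv_cat (eqv_refl P u0) (eqvBP w2))).
  rewrite catA; exact: eqv_cat (eqvAP ha) (eqvBP hb).
Qed.

End Glue.

(** * Hilbert series as polynomials modulo t^N *)

Definition eq_trunc (N : nat) (p q : {poly int}) : Prop :=
  forall k, (k < N)%N -> p`_k = q`_k.

Lemma eq_truncM N p p' q q' : eq_trunc N p p' -> eq_trunc N q q' ->
  eq_trunc N (p * q) (p' * q').
Proof.
move=> hp hq k hk; rewrite !coefM; apply: eq_bigr => i _.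
rewrite hp ?hq //; last by rewrite (leq_ltn_trans _ hk) // -ltnS ltn_ord.
by rewrite (leq_ltn_trans (leq_subr _ _) hk).
Qed.

Definition trunc_series (N : nat) (H : nat -> nat) : {poly int} := \poly_(i < N) (H i)%:Z.

Lemma coef_1subX_exp d j : ((1 - 'X : {poly int}) ^+ d)`_j = (-1) ^+ j * ('C(d, j))%:Z.
Proof.
rewrite exprBn coef_sum.
under eq_bigr => i _ do
  rewrite expr1n mulr1 coefMn -[(-1) ^+ i]/((-1) ^+ i) -(rmorphN1 polyC) -rmorphXn coefCM coefXn.
have [jd|dj] := ltnP j d.+1.
  rewrite (bigD1 (Ordinal jd)) //= eqxx big1 ?addr0 => [|i /negPf ij].
    by rewrite mulr1 -mulr_natr natz.
  by rewrite (_ : (j == i) = false) ?mulr0 ?mul0rn // eq_sym.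
rewrite bin_small // mulr0 big1 // => i _.
by rewrite (_ : (j == i) = false) ?mulr0 ?mul0rn //; apply: gtn_eqF; apply: leq_trans dj.
Qed.

Lemma hpoly_coef_sum d (H : nat -> nat) N k : (k < N)%N ->
  \sum_(j < d.+1 | (j <= k)%N) ((-1) ^+ j * ('C(d, j))%:Z * (H (k - j)%N)%:Z) =
  ((1 - 'X) ^+ d * trunc_series N H)`_k.
Proof.
move=> kN; pose F j : int := (-1) ^+ j * ('C(d, j))%:Z * (H (k - j)%N)%:Z.
rewrite coefM (eq_bigr (fun j : 'I_k.+1 => F j)); last first.
  move=> j _; rewrite coef_1subX_exp coef_poly.
  by rewrite (leq_ltn_trans (leq_subr _ _) kN).
rewrite -(big_mkord xpredT F) -(big_mkord (fun j => (j <= k)%N) F).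
(* Both ranges are widened to a common bound; the extra terms vanish with the binomials. *)
rewrite (big_nat_widen _ _ (d + k).+1); last by rewrite ltnS leq_addr.
rewrite [RHS](big_nat_widen _ _ (d + k).+1); last by rewrite ltnS leq_addl.
rewrite [RHS](bigID (fun j => (j < d.+1)%N)) /= [X in _ = _ + X]big1 ?addr0.
  by apply: eq_bigl => j; rewrite ltnS.
by move=> j /andP[_ hj]; rewrite /F bin_small ?mulr0 ?mul0r // ltnNge -ltnS.
Qed.

Lemma eq_trunc_series_conv N (HA W HP : nat -> nat) :
  (forall k, HP k = \sum_(i < k.+1) HA i * W (k - i))%N ->
  eq_trunc N (trunc_series N HP) (trunc_series N HA * trunc_series N W).
Proof.
move=> h k kN; rewrite coef_poly kN h coefM -natz natr_sum.
apply: eq_bigr => i _; rewrite !coef_poly natrM !natz.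
rewrite (leq_ltn_trans (leq_subr _ _) kN) (leq_ltn_trans _ kN) //.
by rewrite -ltnS ltn_ord.
Qed.

(** The factor 1 counts the single power of [v] in each degree, so [HB] consists of the partial sums
    of [W], and 1 - t takes differences. *)
Lemma eq_trunc_difference N (HB W : nat -> nat) :
  (forall k, HB k = \sum_(i < k.+1) 1 * W (k - i))%N ->
  eq_trunc N (trunc_series N W) ((1 - 'X) * trunc_series N HB).
Proof.
move=> h k kN; rewrite mulrBl mul1r coefB coefXM !coef_poly kN.
case: k kN => [|k] kN /=; rewrite ?(ltnW kN) !h.
  by rewrite big_ord1 mul1n subr0.
rewrite big_ord_recl mul1n subn0.
rewrite (eq_bigr (fun i : 'I_k.+1 => (1 * W (k - i))%N)) => [|i _].
  by rewrite PoszD addrK.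
by rewrite lift0 subSS.
Qed.

Definition cid (T : Type) (Q : T -> Prop) (h : exists x, Q x) : T :=
  proj1_sig (constructive_indefinite_description Q h).

Lemma cidP (T : Type) (Q : T -> Prop) (h : exists x, Q x) : Q (cid h).
Proof. exact: proj2_sig. Qed.

Lemma deg_word_class_reps P k : exists n (t : 'I_n -> seq pt2), class_reps P (deg_word P k) t.
Proof.
by apply: (@finite_class_reps _ _ (words (VS P) k)) => u [<- uV]; apply: mem_words.
Qed.

Lemma hilb_dim_class_reps (K : fieldType) P k n : hilb_dim K P k n ->
  exists t : 'I_n -> seq pt2, class_reps P (deg_word P k) t.
Proof.
move=> h; have [m [t ht]] := deg_word_class_reps P k.
by have e := hilb_dim_inj (class_reps_hilb_dim K ht) h; subst m; exists t.
Qed.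

Lemma inner_fset0 a b : ~ inner_interval fset0 a b.
Proof. by move=> [h1 [h2 h]]; have := h a; rewrite !lexx h1 h2 => /(_ isT isT isT isT). Qed.

Lemma eqv_fset0 u w : eqv fset0 u w -> perm_eq u w.
Proof.
elim=> {u w} [//|a b u /inner_fset0 //|u w _|w u t _ h1 _ h2]; first by rewrite perm_sym.
exact: perm_trans h1 h2.
Qed.

Section HpolyGlue.
Variables (K : fieldType) (A B P : {fset pt2}) (v : pt2).
Hypothesis innerP : forall a b,
  inner_interval P a b <-> inner_interval A a b \/ inner_interval B a b.
Hypothesis VSP : forall p, (p \in VS P) = (p \in VS A) || (p \in VS B).
Hypothesis vA : v \in VS A.
Hypothesis vB : v \in VS B.
Hypothesis meet : forall p, p \in VS A -> p \in VS B -> p = v.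
Hypothesis cancelA : cancellable A [pred p | p \in VS A] v.
Hypothesis cancelB : cancellable B [pred p | p \in VS B] v.

Lemma prim_class_reps (nW : nat -> nat) (tW : forall k, 'I_(nW k) -> seq pt2) :
  (forall k, class_reps B (prim_word B v k) (tW k)) ->
  forall k, hilb_dim K B k (\sum_(i < k.+1) 1 * nW (k - i)).
Proof.
move=> htW k; pose V : pred pt2 := pred1 v.
have [|||||||t ht] := @glue_class_reps fset0 B B V v _ _ _ _ vB _ _ cancelB
   (fun=> 1%N) nW (fun i _ => nseq i v) tW _ htW k.
- by move=> a b; split=> [|[/inner_fset0|]]; [right | |].
- by move=> a b /inner_fset0.
- by move=> p; rewrite /V /=; case: eqP => // ->; rewrite vB.
- exact: eqxx.
- by move=> p /eqP.
- by move=> u w _ _ /eqv_fset0; rewrite perm_cons; apply: eqv_perm.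
- move=> i; split=> [j|j j' _|u [su uv]].
  + by rewrite size_nseq; split=> //; apply/allP => p /nseqP[-> _]; apply: eqxx.
  + by rewrite !ord1.
  + exists ord0; apply: eqv_perm; rewrite -su.
    by have /all_pred1P -> : all (pred1 v) u by []; rewrite size_nseq.
- exact: class_reps_hilb_dim ht.
Qed.

Lemma hpoly_glue hA hB : is_hpoly K A hA -> is_hpoly K B hB -> is_hpoly K P (hA * hB).
Proof.
move=> [A1 [dA [HA [hHA eA]]]] [B1 [dB [HB [hHB eB]]]].
split; first by rewrite hornerM mulf_neq0.
pose tA k := cid (hilb_dim_class_reps (hHA k)).
have htA k : class_reps A (deg_word A k) (tA k) := cidP (hilb_dim_class_reps (hHA k)).
have exW k : exists n (t : 'I_n -> seq pt2), class_reps B (prim_word B v k) t.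
  by apply: (@finite_class_reps _ _ (words (VS B) k)) => u [[<- uV] _]; apply: mem_words.
pose nW k := cid (exW k); pose tW k := cid (cidP (exW k)).
have htW k : class_reps B (prim_word B v k) (tW k) := cidP (cidP (exW k)).
have HBE k : HB k = (\sum_(i < k.+1) 1 * nW (k - i))%N.
  exact: hilb_dim_inj (hHB k) (prim_class_reps htW k).
(* Every power of v is nonzero in K[B], so the Hilbert series is no polynomial. *)
have [d ed] : exists d, dB = d.+1.
  case: dB eB => [|d] eB; last by exists d.
  have [t [_ _ ht]] := hilb_dim_class_reps (hHB (size hB)).
  have [|[i hi] _] := ht (nseq (size hB) v).
    by split; [rewrite size_nseq | apply/allP => p /nseqP[->]].
  have := eB (size hB); rewrite nth_default // (@hpoly_coef_sum _ _ (size hB).+1) //.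
  rewrite expr0 mul1r coef_poly ltnSn => /eqP; rewrite eq_sym => /eqP[e0].
  by rewrite e0 in hi.
pose HP k := (\sum_(i < k.+1) HA i * nW (k - i))%N.
(* The exponent is dA + dB - 1: gluing at a vertex costs one factor 1 - t. *)
exists (dA + d)%N, HP; split=> k.
  have [a b /corners_VS[h1 h2 h3 h4]|t ht] :=
    @glue_class_reps A B P [pred p | p \in VS A] v innerP _ VSP vA vB meet cancelA
     cancelB HA nW tA tW htA htW k; last exact: class_reps_hilb_dim ht.
  by rewrite /= h1 h2 h3 h4.
rewrite (@hpoly_coef_sum _ HP k.+1) //.
have tr d' H (h : {poly int}) : (forall k, h`_k = \sum_(j < d'.+1 | (j <= k)%N)
     ((-1) ^+ j * ('C(d', j))%:Z * (H (k - j)%N)%:Z)) ->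
   eq_trunc k.+1 h ((1 - 'X) ^+ d' * trunc_series k.+1 H).
  by move=> e i ik; rewrite e (hpoly_coef_sum _ _ ik).
have hW := eq_trunc_difference (N := k.+1) HBE.
have hP := eq_trunc_series_conv (N := k.+1) (HA := HA) (W := nW) (HP := HP) (fun k => erefl).
have rf p : eq_trunc k.+1 p p by [].
rewrite (eq_truncM (tr _ _ _ eA) (tr _ _ _ eB)) // (eq_truncM (rf _) hP) //.
rewrite (eq_truncM (rf _) (eq_truncM (rf _) hW)) //.
by rewrite ed exprD exprSr -[_ * trunc_series _ HB]mulrA mulrACA.
Qed.

End HpolyGlue.

(** * Induction on the components *)

Lemma cut_sym P v c d : cut P v c d -> cut P v d c.
Proof. by move=> [g [g1 g2]]; exists g; rewrite eq_sym. Qed.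

(** The two cells are opposite at [v]. Either of the other two cells at [v] would join them by
    edges, so both are missing and [cut_corner] applies. *)
Lemma simple_cut P v c d : is_simple P -> c \in P -> d \in P ->
  v \in cverts c -> v \in cverts d -> c != d -> ~~ share_edge c d ->
  (forall x, x \in P -> share_edge c x -> share_edge x d -> False) -> cut P v c d.
Proof.
wlog le : c d / c.2 <= d.2 => [hw|] simP cP dP vc vd ncd nse nx.
  case: (lerP c.2 d.2) => [le|/ltW le]; first exact: hw.
  apply: cut_sym; apply: hw => // [||x xP e1 e2]; first by rewrite eq_sym.
    by move: nse; rewrite !share_edgeE; clear; lia.
  by apply: (nx x xP); move: e1 e2; rewrite !share_edgeE; clear; lia.
case: v c d => [a b] [e y] [e' y'] in le cP dP vc vd ncd nse nx *.
move: vc vd ncd nse; rewrite !mem_cverts share_edgeE xpair_eqE /= => vc vd ncd nse.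
have ey : y = b - 1 by move: le vc vd ncd nse; clear; rewrite /=; lia.
have ey' : y' = b by move: le vc vd ncd nse; clear; rewrite /=; lia.
have ee : (e == a - 1) && (e' == a) || (e == a) && (e' == a - 1).
  by move: le vc vd ncd nse; clear; rewrite /=; lia.
rewrite {}ey {}ey' {le vc vd ncd nse} in cP dP nx *.
apply: cut_corner => //; apply/negP => /nx; rewrite !share_edgeE /=; apply; move: ee; clear; lia.
Qed.

(** Connectedness as constancy of locally constant colourings spares the handling of paths when [P]
    is cut. *)
Definition edge_connected (Q : {fset pt2}) : Prop := forall g : pt2 -> bool,
  (forall c d, c \in Q -> d \in Q -> share_edge c d -> g c = g d) ->
  forall c d, c \in Q -> d \in Q -> g c = g d.

Definition vertex_connected (P : {fset pt2}) : Prop := forall g : pt2 -> bool,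
  (forall c d w, c \in P -> d \in P -> w \in cverts c -> w \in cverts d -> g c = g d) ->
  forall c d, c \in P -> d \in P -> g c = g d.

Lemma share_edge_vertex v c d : share_edge c d ->
  exists w, [/\ w \in cverts c, w \in cverts d & w != v].
Proof.
case/andP=> _ h; apply: NNPP => nE; move: h; apply/negP; rewrite -leqNgt.
have uc : uniq (cverts c).
  by case: (c) => x y; rewrite /cverts /= !inE !xpair_eqE /=; clear; lia.
apply: (@leq_trans (count_mem v (cverts c))); last by rewrite count_uniq_mem //; case: (_ \in _).
rewrite -!size_filter; apply: uniq_leq_size; first exact: filter_uniq.
move=> w; rewrite !mem_filter => /andP[wd wc]; rewrite wc andbT /=.
by apply/negPn/negP => wv; apply: nE; exists w.
Qed.

Lemma inner_interval_const P (g : pt2 -> bool) a b : inner_interval P a b ->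
  (forall c d, c \in P -> d \in P -> share_edge c d -> g c = g d) ->
  forall c : pt2, a.1 <= c.1 -> c.1 < b.1 -> a.2 <= c.2 -> c.2 < b.2 -> g c = g a.
Proof.
case: a b => [x y] [x' y'] [/= h1 [h2 h]] gP.
have hor n : x + n%:Z < x' -> g (x + n%:Z, y) = g (x, y).
  elim: n => [|n IH] hn; first by rewrite addr0.
  rewrite -IH; last by move: hn; clear; lia.
  by apply/esym/gP; rewrite ?share_edgeE /= ?h //=; move: hn h2; clear; lia.
have ver m n : x + n%:Z < x' -> y + m%:Z < y' -> g (x + n%:Z, y + m%:Z) = g (x, y).
  move=> hn; elim: m => [|m IH] hm; first by rewrite addr0; apply: hor.
  rewrite -IH; last by move: hm; clear; lia.
  by apply/esym/gP; rewrite ?share_edgeE /= ?h //=; move: hn hm; clear; lia.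
move=> [cx cy] /= c1 c2 c3 c4.
have := ver `|cy - y|%N `|cx - x|%N.
have -> : x + `|cx - x|%N%:Z = cx by move: c1; clear; lia.
have -> : y + `|cy - y|%N%:Z = cy by move: c3; clear; lia.
exact.
Qed.

(* part b is the union of the components on one side of the cut point v. *)
Section Split.
Variables (P : {fset pt2}) (v : pt2) (g : pt2 -> bool).
Hypothesis gP : forall c d w, c \in P -> d \in P -> w \in cverts c -> w \in cverts d ->
  w != v -> g c = g d.

Definition part (b : bool) : {fset pt2} := [fset c in P | g c == b]%fset.

Lemma mem_part b c : (c \in part b) = (c \in P) && (g c == b).
Proof. by rewrite !inE. Qed.

Lemma g_edge c d : c \in P -> d \in P -> share_edge c d -> g c = g d.
Proof. by move=> cP dP /(share_edge_vertex v)[w [wc wd wv]]; apply: (gP (w := w)). Qed.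

Lemma part_meet p : p \in VS (part true) -> p \in VS (part false) -> p = v.
Proof.
rewrite !mem_VS => /hasP[c + pc] /hasP[d + pd]; rewrite !mem_part.
move=> /andP[cP /eqP gc] /andP[dP /eqP gd]; apply: NNPP => /eqP pv.
by have := gP cP dP pc pd pv; rewrite gc gd.
Qed.

Lemma inner_part b x y : inner_interval (part b) x y -> inner_interval P x y.
Proof.
move=> [h1 [h2 h]]; do 2!split=> //; move=> c c1 c2 c3 c4.
by have := h c c1 c2 c3 c4; rewrite mem_part => /andP[].
Qed.

Lemma inner_parts x y :
  inner_interval P x y <-> inner_interval (part true) x y \/ inner_interval (part false) x y.
Proof.
split=> [h|[]]; [|exact: inner_part|exact: inner_part].
have hg := inner_interval_const h g_edge; have [h1 [h2 h3]] := h.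
by case e : (g x) hg => hg; [left | right]; do 2!split=> //; move=> c c1 c2 c3 c4;
  rewrite mem_part h3 ?hg.
Qed.

Lemma VS_parts p : (p \in VS P) = (p \in VS (part true)) || (p \in VS (part false)).
Proof.
apply/idP/orP.
  rewrite mem_VS => /hasP[c cP pc]; case e : (g c); [left | right];
  by rewrite mem_VS; apply/hasP; exists c; rewrite ?mem_part ?cP ?e.
by move=> []; rewrite !mem_VS => /hasP[c]; rewrite mem_part => /andP[cP _] pc;
  apply/hasP; exists c.
Qed.

(** The letter is cancelled in [P], then the other part is collapsed to [v]. *)
Lemma part_cancel b : v \in VS (part b) ->
  (forall x, x \in VS P -> cancellable P [pred p | p \in VS P] x) ->
  forall x, x \in VS (part b) -> cancellable (part b) [pred p | p \in VS (part b)] x.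
Proof.
move=> vb canP x xb u w ub wb h; pose V : pred pt2 := [pred p | p \in VS (part b)].
have sub p : p \in VS (part b) -> p \in VS P.
  by rewrite VS_parts; case: (b) => ->; rewrite ?orbT.
have : eqv P u w.
  apply: (canP x (sub _ xb)); [exact: sub_all ub | exact: sub_all wb |].
  by apply: eqv_sub h => a c; apply: inner_part.
rewrite -{2}(retract_id (V := V) v ub) -{2}(retract_id (V := V) v wb).
apply: eqv_retract => a c hac /=.
have {hac} : inner_interval (part b) a c \/ inner_interval (part (~~ b)) a c.
  by move/inner_parts: hac; case: (b) => [[]|[]]; [left|right|right|left].
case=> h'; [left | right]; have [h1 h2 h3 h4] := corners_VS h'.
  by rewrite /V /= h1 h2 h3 h4.
move=> p pc; rewrite /retract; case: ifP => // pb.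
have {pc} : p \in VS (part (~~ b)) by move: pc; rewrite !inE => /or4P[] /eqP ->.
by move: pb; rewrite /V /=; case: (b) => *; apply: part_meet.
Qed.

(** A colouring of one part extends to [P] by its value at a cell containing [v], since the parts
    touch only there. *)
Lemma part_connected b x0 : x0 \in part b -> v \in cverts x0 ->
  vertex_connected P -> vertex_connected (part b).
Proof.
move=> x0b vx0 conP h hb c d cb db.
pose h' x := if g x == b then h x else h x0.
have h'E x : x \in part b -> h' x = h x by rewrite mem_part /h' => /andP[_ ->].
have subP x : x \in part b -> x \in P by rewrite mem_part => /andP[].
rewrite -(h'E c) // -(h'E d) //; apply: conP; try exact: subP.
have one x y w : x \in P -> y \in P -> w \in cverts x -> w \in cverts y ->
    g x == b -> g y != b -> h x = h x0.
  move=> xP yP wx wy gx gy; have wv : w = v.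
    by apply: NNPP => /eqP wv; move: gy; rewrite -(gP xP yP wx wy wv) gx.
  by apply: (hb _ _ v) => //; [rewrite mem_part xP | rewrite -wv].
move=> x y w xP yP wx wy; rewrite /h'.
case: ifP => gx; case: ifP => gy //.
- by apply: (hb _ _ w); rewrite ?mem_part ?xP ?yP.
- by apply: (one x y w); rewrite ?gy.
- by apply/esym/(one y x w); rewrite ?gx.
Qed.

Lemma part_cut b v' c d : cut P v' c d -> cut (part b) v' c d.
Proof.
move=> [f [f1 f2]]; exists f; split=> // c' d' w; rewrite !mem_part.
by move=> /andP[c'P _] /andP[d'P _]; apply: f2.
Qed.

End Split.

Section Induction.
Variable K : fieldType.

Definition meets (g : pt2 -> bool) (b : bool) (q : {fset pt2} * {poly int}) : bool :=
  has (fun c => g c == b) q.1.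

(** The invariant of the induction: simplicity is represented by its consequences [dec_cut] and
    [dec_cancel], which pass to the parts of a cut. *)
Record decomposition (L : seq ({fset pt2} * {poly int})) (P : {fset pt2}) : Prop := {
  dec_nonempty : L != [::];
  dec_uniq : uniq (map fst L);
  dec_mem : forall c, reflect (exists2 q, q \in L & c \in q.1) (c \in P);
  dec_pick : forall q, q \in L -> exists c, c \in q.1;
  dec_edge : forall q, q \in L -> edge_connected q.1;
  dec_disjoint : forall q q' c, q \in L -> q' \in L -> c \in q.1 -> c \in q'.1 -> q.1 = q'.1;
  dec_vertex : vertex_connected P;
  dec_cut : forall v c d, c \in P -> d \in P -> v \in cverts c -> v \in cverts d ->
    (forall q, q \in L -> c \in q.1 -> d \in q.1 -> False) -> cut P v c d;
  dec_cancel : forall v, v \in VS P -> cancellable P [pred p | p \in VS P] v;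
  dec_hpoly : forall q, q \in L -> is_hpoly K q.1 q.2
}.

Lemma decomposition_part L P v g b x0 y0 : decomposition L P ->
  (forall c d w, c \in P -> d \in P -> w \in cverts c -> w \in cverts d ->
    w != v -> g c = g d) ->
  x0 \in part P g b -> v \in cverts x0 -> y0 \in P -> g y0 != b ->
  let L' := [seq q <- L | meets g b q] in
  decomposition L' (part P g b) /\ (size L' < size L)%N.
Proof.
move=> [D0 D1 D2 D3 D4 D5 D6 D7 D8 D9] gP x0b vx0 y0P gy0 L'.
have gq q c d : q \in L -> c \in q.1 -> d \in q.1 -> g c = g d.
  move=> qL; apply: D4 => // x y xq yq; apply: (g_edge (P := P) gP); apply/D2; by exists q.
have L'L q : q \in L' -> q \in L by rewrite mem_filter => /andP[].
have memL' q c : q \in L -> c \in q.1 -> (q \in L') = (g c == b).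
  move=> qL cq; rewrite mem_filter qL andbT; apply/hasP/idP => [[d dq /eqP <-]|gc].
    by rewrite (gq q d c).
  by exists c.
have memP c : reflect (exists2 q, q \in L' & c \in q.1) (c \in part P g b).
  rewrite mem_part; apply: (iffP andP) => [[/D2[q qL cq] gc]|[q qL' cq]].
    by exists q => //; rewrite (memL' q c).
  by split; [apply/D2; exists q => //; apply: L'L | rewrite -(memL' q c) //; apply: L'L].
split; last first.
  rewrite size_filter ltn_neqAle count_size -all_count andbT.
  have /D2[q qL yq] := y0P; apply/allPn; exists q => //.
  by have := memL' q y0 qL yq; rewrite mem_filter qL andbT => ->.
split=> //.
- by have /memP[q qL' _] := x0b; apply: contraTneq qL' => ->.
- by apply: subseq_uniq D1; apply: map_subseq; apply: filter_subseq.
- by move=> q /L'L; apply: D3.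
- by move=> q /L'L; apply: D4.
- by move=> q q' c /L'L h /L'L; apply: D5.
- exact: part_connected x0b vx0 D6.
- move=> v' c d; rewrite !mem_part => /andP[cP gc] /andP[dP gd] v'c v'd no.
  by apply: part_cut; apply: D7 => // q qL cq dq; apply: (no q) => //; rewrite (memL' q c).
- exact: (part_cancel gP (mem_VS_cell x0b vx0) D8).
- by move=> q /L'L; apply: D9.
Qed.

Lemma decomposition_hpoly L P : decomposition L P -> is_hpoly K P (\prod_(q <- L) q.2).
Proof.
have [n] := ubnP (size L); elim: n L P => // n IH L P sz D.
have [D0 D1 D2 D3 D4 D5 D6 D7 D8 D9] := D.
case: L D0 D1 D2 D3 D4 D5 D7 D9 sz D => [//|q1 [|q2 L]] D0 D1 D2 D3 D4 D5 D7 D9 sz D.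
  rewrite big_seq1 (_ : P = q1.1); first by apply: D9; apply: mem_head.
  apply/fsetP => c; apply/D2/idP => [[q]|cq]; first by rewrite inE => /eqP ->.
  by exists q1 => //; apply: mem_head.
move eL : [:: q1, q2 & L] D0 D1 D2 D3 D4 D5 D7 D9 sz D => L0 D0 D1 D2 D3 D4 D5 D7 D9 sz D.
have q1L : q1 \in L0 by rewrite -eL mem_head.
have q2L : q2 \in L0 by rewrite -eL !inE eqxx orbT.
have n12 : q1.1 != q2.1 by move: D1; rewrite -eL /= inE negb_or => /andP[/andP[]].
(* Weak connectedness provides a vertex where the component [q1] touches another one. *)
have [c [d [v [[cP dP] [vc vd] cq dq]]]] : exists c d v,
    [/\ c \in P /\ d \in P, v \in cverts c /\ v \in cverts d, c \in q1.1 & d \notin q1.1].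
  apply: NNPP => nE; have [c1 c1q] := D3 _ q1L; have [c2 c2q] := D3 _ q2L.
  have : (c1 \in q1.1) = (c2 \in q1.1).
    apply: (D6 (fun x => x \in q1.1)); [|by apply/D2; exists q1|by apply/D2; exists q2].
    move=> x y w xP yP wx wy; case xq: (x \in q1.1); case yq: (y \in q1.1) => //; case: nE.
      by exists x, y, w; rewrite xq yq.
    by exists y, x, w; rewrite xq yq.
  rewrite c1q => /esym c2q1; move: n12; by rewrite (D5 _ _ _ q1L q2L c2q1 c2q) eqxx.
have [|g [g1 g2]] := D7 v c d cP dP vc vd.
  by move=> q qL cq'; rewrite -(D5 _ _ _ q1L qL cq cq') (negPf dq).
have ends b : exists x0 y0, [/\ x0 \in part P g b, v \in cverts x0, y0 \in P & g y0 != b].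
  case: (eqVneq (g c) b) => gc.
    by exists c, d; rewrite mem_part cP gc eqxx -gc eq_sym.
  exists d, c; rewrite mem_part dP; split=> //=.
  by move: g1 gc; case: (g c) (g d) (b) => [] [] [].
have ih b : is_hpoly K (part P g b)
    (\prod_(q <- [seq q <- L0 | meets g b q]) q.2).
  have [x0 [y0 [h1 h2 h3 h4]]] := ends b.
  have [D' lt] := decomposition_part D g2 h1 h2 h3 h4.
  by apply: IH D'; apply: leq_trans lt _.
rewrite (bigID (meets g true)) /=.
(* A component is connected by edges, so it lies on exactly one side of the cut. *)
have eqF : \prod_(i <- L0 | ~~ meets g true i) i.2 =
    \prod_(q <- [seq q <- L0 | meets g false q]) q.2.
  rewrite big_filter big_seq_cond [RHS]big_seq_cond; apply: eq_bigl => q.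
  have [qL|//] := boolP (q \in L0); rewrite /=.
  have [x xq] := D3 _ qL.
  have hx b : meets g b q = (g x == b).
    apply/hasP/idP => [[y yq /eqP <-]|gx]; last by exists x.
    apply/eqP; apply: (D4 _ qL g) => // a a' aq a'q.
    by apply: (g_edge (P := P) g2); apply/D2; exists q.
  by rewrite !hx; case: (g x).
rewrite eqF -big_filter.
have vpart b : v \in VS (part P g b).
  by have [x0 [_ [h1 h2 _ _]]] := ends b; apply: mem_VS_cell h1 h2.
have can b : cancellable (part P g b) [pred p | p \in VS (part P g b)] v.
  by apply: (part_cancel g2 (vpart b) D8); apply: vpart.
exact: (hpoly_glue (inner_parts g2) (@VS_parts P g) (vpart true) (vpart false)
  (part_meet g2) (can true) (can false) (ih true) (ih false)).
Qed.

End Induction.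

(** * Connected components of a simple collection *)

Lemma share_edge_sym c d : share_edge c d = share_edge d c.
Proof. by rewrite !share_edgeE; clear; lia. Qed.

Lemma joined_refl r A c : joined r A c c.
Proof. by exists [::]. Qed.

Lemma joined_trans r A d c e : joined r A c d -> joined r A d e -> joined r A c e.
Proof.
move=> [s [s1 [s2 s3]]] [t [t1 [t2 t3]]]; exists (s ++ t).
by rewrite all_cat s1 cat_path s2 last_cat s3.
Qed.

Lemma joined_step (r : rel pt2) (A : pred pt2) c d : A d -> r c d -> joined r A c d.
Proof. by move=> Ad rcd; exists [:: d]; rewrite /= Ad rcd. Qed.

Lemma joined_sym (r : rel pt2) (A : pred pt2) c d : (forall x y, r x y = r y x) -> A c ->
  joined r A c d -> joined r A d c.
Proof.
move=> rs Ac [s [As [ps <-]]]; elim: s c Ac As ps => [|x s IH] c Ac /=.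
  by move=> *; apply: joined_refl.
case/andP=> Ax As /andP[rcx ps]; apply: joined_trans (IH x Ax As ps) _.
by apply: joined_step; rewrite // rs.
Qed.

Definition comp (P : {fset pt2}) (c : pt2) : {fset pt2} :=
  [fset d in P | asb (joined share_edge (fun x => x \in P) c d)]%fset.

Lemma mem_comp P c d :
  reflect (d \in P /\ joined share_edge (fun x => x \in P) c d) (d \in comp P c).
Proof. by rewrite !inE; apply: (iffP andP) => -[? /asbP]. Qed.

Lemma comp_self P c : c \in P -> c \in comp P c.
Proof. by move=> cP; apply/mem_comp; split=> //; apply: joined_refl. Qed.

Lemma joined_in_comp P c d : joined share_edge (fun x => x \in P) c d ->
  joined share_edge (fun x => x \in comp P c) c d.
Proof.
move=> [s [Ps [ps <-]]]; exists s; split=> //; apply/allP => x xs; apply/mem_comp.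
split; first exact: (allP Ps).
case/splitPr: xs Ps ps => s1 s2; rewrite all_cat cat_path /= => /and3P[h1 h2 _] /and3P[h3 h4 _].
by exists (rcons s1 x); rewrite all_rcons h1 h2 rcons_path h3 h4 last_rcons.
Qed.

Lemma comp_component P c : c \in P -> is_component P (comp P c).
Proof.
move=> cP; have sub : (comp P c `<=` P)%fset by apply/fsubsetP => x /mem_comp[].
have cc := comp_self cP; split=> //; split=> [|Q cQ QP [_ polQ]].
  split; first by apply/fset0Pn; exists c.
  move=> d e /mem_comp[_ /joined_in_comp jd] /mem_comp[_ /joined_in_comp je].
  exact: joined_trans (joined_sym share_edge_sym cc jd) je.
apply/eqP; rewrite eqEfsubset cQ andbT; apply/fsubsetP => x xQ; apply/mem_comp.
split; first exact: (fsubsetP QP).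
have [s [Qs h]] := polQ _ _ (fsubsetP cQ _ cc) xQ; exists s; split=> //.
by apply: sub_all Qs => y /(fsubsetP QP).
Qed.

Lemma component_eq P Q c : is_component P Q -> c \in Q -> Q = comp P c.
Proof.
move=> [QP [[_ polQ] maxQ]] cQ; have cP := fsubsetP QP _ cQ.
have [cc [cpol _]] := comp_component cP; apply/esym/maxQ => //.
apply/fsubsetP => x xQ; apply/mem_comp; split; first exact: (fsubsetP QP).
have [s [Qs h]] := polQ _ _ cQ xQ; exists s; split=> //.
by apply: sub_all Qs => y /(fsubsetP QP).
Qed.

Lemma components_decomposition (K : fieldType) (P : {fset pt2})
    (comps : seq {fset pt2}) (hs : seq {poly int}) :
  is_collection P -> is_simple P -> uniq comps ->
  (forall Q, Q \in comps <-> is_component P Q) -> size hs = size comps ->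
  (forall i, (i < size comps)%N -> is_hpoly K (nth fset0 comps i) (nth 0 hs i)) ->
  decomposition K (zip comps hs) P.
Proof.
move=> [/fset0Pn[c0 c0P] conP] simP ucomps compsP szh hpol.
have fstE : map fst (zip comps hs) = comps by apply: unzip1_zip; rewrite szh.
have qcomp q : q \in zip comps hs -> is_component P q.1.
  by move=> qL; apply/compsP; rewrite -fstE map_f.
have cellQ c : c \in P -> exists2 q, q \in zip comps hs & q.1 = comp P c.
  move=> cP; have : comp P c \in map fst (zip comps hs).
    by rewrite fstE; apply/compsP/comp_component.
  by case/mapP=> q qL e; exists q.
split.
- by have [q + _] := cellQ _ c0P; case: (zip _ _).
- by rewrite fstE.
- move=> c; apply: (iffP idP) => [cP|[q /qcomp[qP _] cq]].
    by have [q qL e] := cellQ c cP; exists q => //; rewrite e comp_self.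
  exact: (fsubsetP qP).
- by move=> q /qcomp[_ [[/fset0Pn]]].
- move=> q /qcomp[_ [[_ polq] _]] g hg c d cq dq.
  exact: joined_const hg cq (polq _ _ cq dq).
- by move=> q q' c /qcomp h /qcomp h' cq cq'; rewrite (component_eq h cq) (component_eq h' cq').
- move=> g hg c d cP dP; apply: joined_const cP (conP _ _ cP dP) => x y xP yP.
  by case/share_vertexP => w wx wy; apply: (hg x y w).
- move=> v c d cP dP vc vd no.
  have {}no : ~ joined share_edge (fun x => x \in P) c d.
    move=> h; have [q qL e] := cellQ c cP; apply: (no q qL); rewrite e ?comp_self //.
    exact/mem_comp.
  apply: simple_cut => //.
  + by apply/eqP => e; apply: no; rewrite e; apply: joined_refl.
  + by apply/negP => e; apply: no; apply: joined_step.
  + move=> x xP e1 e2; apply: no; apply: (joined_trans (d := x)); exact: joined_step.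
- by move=> v _ u w _ _; apply: simple_cancel.
- move=> q /(nthP (fset0, 0))[i]; rewrite size_zip szh minnn => hi <-.
  by rewrite nth_zip //; apply: hpol.
Qed.

Theorem theorem2p2 (K : fieldType) (P : {fset pt2})
    (comps : seq {fset pt2}) (hs : seq {poly int}) :
  is_collection P -> is_simple P ->
  uniq comps -> (forall Q, Q \in comps <-> is_component P Q) ->
  size hs = size comps ->
  (forall i, (i < size comps)%N -> is_hpoly K (nth fset0 comps i) (nth 0 hs i)) ->
  is_hpoly K P (\prod_(h <- hs) h).
Proof.
move=> colP simP ucomps compsP szh hpol.
have /decomposition_hpoly := components_decomposition colP simP ucomps compsP szh hpol.
have sndE : map snd (zip comps hs) = hs by apply: unzip2_zip; rewrite szh.
by rewrite -[in X in _ -> X]sndE big_map.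
Qed.
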